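(* Let $\mathcal H_A,\mathcal H_B$ be finite-dimensional Hilbert spaces with fixed orthonormal bases, let $\mathcal N\colon S(\mathcal H_A)\to S(\mathcal H_B)$ be a quantum channel, and let $\sigma\in S(\mathcal H_A)$. Let $\mathcal R_{\sigma,\mathcal N}$ be the twirled Petz map $$\mathcal R_{\sigma,\mathcal N}[\gamma]=\int_{\mathbb R}dt\,\beta_0(t)\,\sigma^{-\frac{it}2}\,\mathcal P_{\sigma,\mathcal N}\bigl[\mathcal N[\sigma]^{\frac{it}2}\,\gamma\,\mathcal N[\sigma]^{-\frac{it}2}\bigr]\,\sigma^{\frac{it}2},\qquad\beta_0(t)=\tfrac{\pi}{2}(\cosh(\pi t)+1)^{-1},$$ where $\mathcal P_{\sigma,\mathcal N}[\gamma]=\sigma^{1/2}\,\mathcal N^*\bigl[\mathcal N[\sigma]^{-1/2}\,\gamma\,\mathcal N[\sigma]^{-1/2}\bigr]\,\sigma^{1/2}$ is the Petz map. Then the Choi operator of $\mathcal R_{\sigma,\mathcal N}$ can be expressed as $$\Phi_{\mathcal R_{\sigma,\mathcal N}}=\frac{d}{dt}\Big|_{t=0}\log\bigl(\overline{\mathcal N[\sigma]}\otimes\sigma^{-1}+t\,\Phi_{\mathcal N^*}\bigr),$$ where $\overline{\mathcal N[\sigma]}$ is the complex conjugate of $\mathcal N[\sigma]$ and $\sigma^{-1}$ is the inverse of $\sigma$ on its support.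
   Context: $S(\mathcal H)$ is the set of density operators on $\mathcal H$. A quantum channel is a completely positive trace-preserving map, extended linearly to all operators; $\mathcal N^*$ is its adjoint, $\operatorname{tr}(\mathcal N[\rho]\phi)=\operatorname{tr}(\rho\,\mathcal N^*[\phi])$. For a completely positive map $\mathcal M$ from operators on $\mathcal H$ to operators on $\mathcal K$, the Choi operator is $\Phi_{\mathcal M}=(\operatorname{id}\otimes\mathcal M)[\Phi]$, an operator on $\mathcal H\otimes\mathcal K$, where $\Phi=|\Phi\rangle\langle\Phi|$ and $|\Phi\rangle=\sum_j|j\rangle|j\rangle\in\mathcal H\otimes\mathcal H$ is the unnormalized maximally entangled state in the fixed orthonormal basis. $\overline{X}$ is the entrywise complex conjugate of $X$ in this basis. The logarithm is natural. If $\sigma$ or $\mathcal N[\sigma]$ is not full rank, their negative and imaginary powers are taken on their supports (zero on the kernel), and the logarithm is taken on the support of $\overline{\mathcal N[\sigma]}\otimes\sigma^{-1}$ (zero on the kernel). *)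

(* Defs.v *)
From HB Require Import structures.
From mathcomp Require Import all_boot all_order all_algebra.
From mathcomp Require Import spectral complex mxtens.
From mathcomp Require Import all_classical all_reals all_analysis.

Set Implicit Arguments.
Unset Strict Implicit.
Unset Printing Implicit Defensive.

Import Order.TTheory GRing.Theory Num.Theory.
Import numFieldNormedType.Exports.

Local Open Scope ring_scope.
Local Open Scope complex_scope.
Local Open Scope sesquilinear_scope.

(* Operators on a Hilbert space of dimension n with a fixed orthonormal basis
   are matrices 'M[R[i]]_n; operators on H (x) K are matrices of size
   n * m, with the index pairing mxtens_index and the Kronecker product *t. *)

Section States.
Context {R : realType}.
Local Notation C := R[i].

(* In the order of R[i], 0 <= z entails that z is real, so a positive
   semidefinite matrix is Hermitian. *)
Definition psdmx n (A : 'M[C]_n) : Prop :=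
  forall v : 'cV[C]_n, 0 <= (v ^t* *m A *m v) 0 0.

Definition density n (A : 'M[C]_n) : Prop := psdmx A /\ \tr A = 1.

End States.

Section Maps.
Context {R : realType}.
Local Notation C := R[i].

(* The (i, j) block of X, i.e. X = \sum_(i, j) |i><j| (x) tensblock X i j. *)
Definition tensblock k n (X : 'M[C]_(k * n)) (i j : 'I_k) : 'M[C]_n :=
  \matrix_(a, b) X (mxtens_index (i, a)) (mxtens_index (j, b)).

(* id (x) M, for a linear map M. *)
Definition idtens k n m (M : 'M[C]_n -> 'M[C]_m) (X : 'M[C]_(k * n)) :
    'M[C]_(k * m) :=
  \sum_(i < k) \sum_(j < k) (delta_mx i j *t M (tensblock X i j)).

Definition completely_positive n m (M : 'M[C]_n -> 'M[C]_m) : Prop :=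
  forall (k : nat) (X : 'M[C]_(k * n)), psdmx X -> psdmx (idtens M X).

Definition trace_preserving n m (M : 'M[C]_n -> 'M[C]_m) : Prop :=
  forall X : 'M[C]_n, \tr (M X) = \tr X.

Definition quantum_channel n m (N : {linear 'M[C]_n -> 'M[C]_m}) : Prop :=
  completely_positive N /\ trace_preserving N.

(* The entries of the adjoint are forced by its defining property
   tr (N rho *m phi) = tr (rho *m N^* phi), see adjmapP and adjmap_unique. *)
Definition adjmap n m (N : 'M[C]_n -> 'M[C]_m) (phi : 'M[C]_m) : 'M[C]_n :=
  \matrix_(i, j) \tr (N (delta_mx j i) *m phi).

Lemma mxtrace_delta_mul n (j i : 'I_n) (A : 'M[C]_n) :
  \tr (delta_mx j i *m A) = A i j.
Proof.
rewrite /mxtrace (bigD1 j) //= big1 ?addr0 => [|k kj].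
  rewrite mxE (bigD1 i) //= big1 ?addr0 => [|l li]; rewrite !mxE ?eqxx ?mul1r //.
  by rewrite (negPf li) andbF mul0r.
by rewrite mxE big1 // => l _; rewrite mxE (negPf kj) mul0r.
Qed.

Lemma adjmapP n m (N : {linear 'M[C]_n -> 'M[C]_m}) rho phi :
  \tr (N rho *m phi) = \tr (rho *m adjmap N phi).
Proof.
rewrite {1 2}(matrix_sum_delta rho) linear_sum !mulmx_suml !linear_sum /=.
apply: eq_bigr => j _; rewrite linear_sum !mulmx_suml !linear_sum /=.
apply: eq_bigr => i _; rewrite linearZ -!scalemxAl !linearZ /=; congr (_ * _).
by rewrite mxtrace_delta_mul mxE.
Qed.

Lemma adjmap_unique n m (N : {linear 'M[C]_n -> 'M[C]_m}) M' :
  (forall rho phi, \tr (N rho *m phi) = \tr (rho *m M' phi)) ->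
  M' =1 adjmap N.
Proof.
move=> NM' phi; apply/matrixP => i j.
by rewrite -mxtrace_delta_mul -NM' mxE.
Qed.

(* The sum has size (n * n) x (1 * 1). *)
Definition maxent_ket n : 'cV[C]_(n * n) :=
  \sum_(j < n) ((delta_mx j 0 : 'cV[C]_n) *t (delta_mx j 0 : 'cV[C]_n)).

Definition maxent_op n : 'M[C]_(n * n) := maxent_ket n *m (maxent_ket n) ^t*.

Definition choi n m (M : 'M[C]_n -> 'M[C]_m) : 'M[C]_(n * m) :=
  idtens M (maxent_op n).

End Maps.

Section FunctionalCalculus.
Context {R : realType}.
Local Notation C := R[i].

(* Functional calculus of a Hermitian matrix A (whose eigenvalues are real). *)
Definition mxfun (f : R -> C) n (A : 'M[C]_n) : 'M[C]_n :=
  invmx (spectralmx A)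
    *m diag_mx (map_mx (fun z : C => f (complex.Re z)) (spectral_diag A))
    *m spectralmx A.

(* x ^ z = exp (z ln x) for x > 0, and 0 for x <= 0: for positive
   semidefinite A, mxpow A z is the power on the support of A and vanishes on
   the kernel of A. *)
Definition cpow (z : C) (x : R) : C :=
  if 0 < x then (expR (complex.Re z * ln x))%:C *
                (cos (complex.Im z * ln x) +i* sin (complex.Im z * ln x))
  else 0.

Definition mxpow n (A : 'M[C]_n) (z : C) : 'M[C]_n := mxfun (cpow z) A.

Definition suppmx n (A : 'M[C]_n) : 'M[C]_n :=
  mxfun (fun x => (x != 0)%:R) A.

(* Logarithm of Y on the support of X: Y is compressed to that support; the
   result vanishes on the kernel of X because ln 0 = 0. *)
Definition log_on n (X Y : 'M[C]_n) : 'M[C]_n :=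
  mxfun (fun x => (ln x)%:C) (suppmx X *m Y *m suppmx X).

End FunctionalCalculus.

Section Calculus.
Context {R : realType}.
Local Notation C := R[i].

Definition integral_mx m n (F : R -> 'M[C]_(m, n)) : 'M[C]_(m, n) :=
  \matrix_(i, j)
    ((\int[lebesgue_measure]_t complex.Re (F t i j))
     +i* (\int[lebesgue_measure]_t complex.Im (F t i j))).

(* F is differentiable at t0, with derivative D. *)
Definition is_derive_mx m n (t0 : R) (F : R -> 'M[C]_(m, n))
    (D : 'M[C]_(m, n)) : Prop :=
  forall i j,
    is_derive t0 1 (fun t => complex.Re (F t i j)) (complex.Re (D i j)) /\
    is_derive t0 1 (fun t => complex.Im (F t i j)) (complex.Im (D i j)).

End Calculus.

Section Petz.
Context {R : realType}.
Local Notation C := R[i].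

Definition petz n m (sigma : 'M[C]_n) (N : 'M[C]_n -> 'M[C]_m)
    (gamma : 'M[C]_m) : 'M[C]_n :=
  mxpow sigma (1 / 2)%:C
    *m adjmap N (mxpow (N sigma) (- (1 / 2))%:C *m gamma
                   *m mxpow (N sigma) (- (1 / 2))%:C)
    *m mxpow sigma (1 / 2)%:C.

Definition cosh (x : R) : R := (expR x + expR (- x)) / 2.

Definition beta0 (t : R) : R := pi / 2 * (cosh (pi * t) + 1)^-1.

Definition twirled_petz n m (sigma : 'M[C]_n) (N : 'M[C]_n -> 'M[C]_m)
    (gamma : 'M[C]_m) : 'M[C]_n :=
  integral_mx (fun t : R => (beta0 t)%:C *:
    (mxpow sigma (0 -i* (t / 2))
       *m petz sigma N (mxpow (N sigma) (0 +i* (t / 2)) *m gamma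
                          *m mxpow (N sigma) (0 -i* (t / 2)))
       *m mxpow sigma (0 +i* (t / 2)))).

End Petz.

(* Main.v *)
Require Import Defs.
From HB Require Import structures.
From mathcomp Require Import all_boot all_order all_algebra.
From mathcomp Require Import spectral complex mxtens ring lra.
From mathcomp Require Import all_classical all_reals all_analysis.
From mathcomp Require Import measurable_realfun.

Set Implicit Arguments.
Unset Strict Implicit.
Unset Printing Implicit Defensive.

Import Order.TTheory GRing.Theory Num.Theory.
Import numFieldNormedType.Exports.
Import ComplexField.Normc.
Local Open Scope ring_scope.
Local Open Scope complex_scope.

(* Let X = conj (N sigma) (x) sigma^-1 have eigenvalues x_p. In an eigenbasis of X
   the derivative of log at X in the direction Phi is the Schur product of Phi
   with the divided differences (ln x_p - ln x_q) / (x_p - x_q), on the support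
   of X. The Choi operator of the rotated Petz map at time t is
   X^((-1 + it)/2) Phi X^((-1 - it)/2), where Phi is the Choi operator of N^*, so
   the twirling integral gives the Schur multiplier
   (x_p x_q)^(-1/2) beta0_hat ((ln x_p - ln x_q) / 2), beta0_hat being the Fourier
   transform of beta0. Both multipliers agree because beta0_hat w = w / sinh w. *)

(** * The Fourier transform of beta0 *)

Section LogisticDensity.
Context {R : realType}.
Local Open Scope classical_set_scope.
Local Open Scope ring_scope.
Implicit Types (s t w y T : R).
Local Notation mu := (@lebesgue_measure R).

(** The Fourier transform is evaluated without residues. The poles of [beta0] nearest to the real
    axis are i and -i, and a shift by the full period 2i would cross one. A shift by i/2 stays where
    the extension is holomorphic and, by the half-angle formula, relates [beta0_hat w] to
    [beta0_hat (w / 2)]. Iterated, with continuity at 0 and total mass 1, this relation determines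
    [beta0_hat]. On the side of the logarithm the obstacle is that [ln] is unbounded near 0 while X
    may be singular. Compression to the support keeps the kernel of X in the kernel of the perturbed
    operator, so no spurious small eigenvalues come from there. The error is bounded by a multiple
    of t^2 straight from the eigenvector equation of the perturbed matrix; continuity or
    differentiability of the eigenvalues in t is never invoked. *)

Lemma cosh_gt0 t : 0 < cosh t.
Proof. by rewrite /cosh divr_gt0 // addr_gt0 // expR_gt0. Qed.

Lemma cosh_ge1 t : 1 <= cosh t.
Proof.
rewrite /cosh expRN ler_pdivlMr // mul1r.
have e0 := expR_gt0 t.
have -> : expR t + (expR t)^-1 = 2 + (expR t - 1) ^+ 2 / expR t.
  by field; rewrite gt_eqF.
by rewrite lerDl divr_ge0 ?sqr_ge0 // ltW.
Qed.

Definition sinh t : R := (expR t - expR (- t)) / 2.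

Lemma sqr_cosh t : cosh t ^+ 2 = 1 + sinh t ^+ 2.
Proof. by rewrite /cosh /sinh expRN; field; rewrite gt_eqF ?expR_gt0. Qed.

Lemma normr_sinh t : `|sinh t| <= cosh t.
Proof.
rewrite -[leRHS]ger0_norm ?(ltW (cosh_gt0 _)) //.
by rewrite -(ler_sqr (normr_ge0 _) (normr_ge0 _)) !real_normK ?num_real // sqr_cosh lerDr.
Qed.

Lemma is_derive_cosh t : is_derive t 1 cosh (sinh t).
Proof.
rewrite /cosh /sinh; apply: is_derive_eq.
by rewrite /GRing.scale /=; field.
Qed.

Lemma is_derive_sinh t : is_derive t 1 sinh (cosh t).
Proof.
rewrite /cosh /sinh; apply: is_derive_eq.
by rewrite /GRing.scale /=; field.
Qed.

Lemma continuous_cosh : continuous (@cosh R).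
Proof.
move=> t; apply/differentiable_continuous/derivable1_diffP.
by have [] := is_derive_cosh t.
Qed.

Lemma beta0_ge0 t : 0 <= beta0 t :> R.
Proof.
rewrite /beta0 mulr_ge0 ?divr_ge0 ?pi_ge0 // invr_ge0 addr_ge0 // ltW //.
exact: cosh_gt0.
Qed.

Lemma beta0N t : beta0 (- t) = beta0 t :> R.
Proof. by rewrite /beta0 /cosh mulrN opprK (addrC (expR _)). Qed.

Lemma continuous_beta0 : continuous (@beta0 R).
Proof.
move=> t; rewrite /beta0; apply: cvgM; first exact: cvg_cst.
apply: cvgV; first by rewrite gt_eqF // addr_gt0 // cosh_gt0.
apply: cvgD; last exact: cvg_cst.
apply: continuous_comp; last exact: continuous_cosh.
by apply: cvgM; [exact: cvg_cst | exact: cvg_id].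
Qed.

(** [beta0 t] equals pi e / (e + 1)^2 with e = exp (pi t), the logistic density; this is its
    distribution function minus 1, normalized to vanish at +oo. *)
Definition beta0_prim t : R := - (expR (pi * t) + 1)^-1.

Let is_derive_beta0_prim t : is_derive t 1 beta0_prim (beta0 t).
Proof.
have e0 := expR_gt0 (pi * t).
have ne0 : expR (pi * t) + 1 != 0 by rewrite gt_eqF // addr_gt0.
rewrite /beta0_prim; apply: is_derive_eq.
rewrite /GRing.scale /= /beta0 /cosh expRN.
move: e0 ne0; set e := expR _ => e0 ne0.
have ne1 : e * e + 1 + e * 2 != 0.
  by rewrite (_ : _ + _ = (e + 1)^+2) ?expf_neq0 //; ring.
field.
by rewrite (gt_eqF e0) ne0 ne1.
Qed.

Let cvg_beta0_prim : beta0_prim t @[t --> +oo%R] --> (0:R).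
Proof.
apply/cvgrPdist_lt => e e0; near=> t.
have t0 : e^-1 / pi < t by near: t; apply: nbhs_pinfty_gt; rewrite num_real.
rewrite sub0r normrN /beta0_prim normrN normfV gtr0_norm; last first.
  by rewrite addr_gt0 // expR_gt0.
rewrite invf_plt ?posrE // ?addr_gt0 // ?expR_gt0 //.
move: t0; rewrite ltr_pdivrMr ?pi_gt0 // mulrC => /lt_le_trans; apply.
have := expR_ge1Dx (pi * t); lra.
Unshelve. all: end_near. Qed.

(** By evenness this is twice the integral over the half-line, where [beta0_prim] rises from -1/2 to
    0. *)
Lemma integral_beta0 : (\int[mu]_t (beta0 t)%:E = 1)%E.
Proof.
rewrite (ge0_symfun_integralT beta0_ge0 continuous_beta0); last first.
  by move=> t; rewrite /= beta0N.
rewrite -set_itvcy.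
rewrite (@ge0_continuous_FTC2y _ beta0 beta0_prim 0 0) //.
- rewrite /beta0_prim mulr0 expR0 -EFinB -EFinM; congr EFin; by field.
- by move=> t _; exact: beta0_ge0.
- exact/continuous_subspaceT/continuous_beta0.
- apply: cvg_at_right_filter.
  by apply/differentiable_continuous/derivable1_diffP; have [] := is_derive_beta0_prim 0.
- by move=> t _; rewrite derive1E; have [] := is_derive_beta0_prim t.
Qed.

Lemma integrable_beta0 : mu.-integrable setT (EFin \o (@beta0 R)).
Proof.
apply/integrableP; split.
  by apply/measurable_EFinP; apply: continuous_measurable_fun; exact: continuous_beta0.
under eq_integral do rewrite /= ger0_norm ?beta0_ge0 //.
by rewrite integral_beta0 ltry.
Qed.

Lemma integrable_beta0M (f : R -> R) : continuous f ->
  (forall t, `|f t| <= 1) -> mu.-integrable setT (EFin \o (fun t => beta0 t * f t)).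
Proof.
move=> cf f1; apply: le_integrable integrable_beta0 => //.
  apply/measurable_EFinP; apply: continuous_measurable_fun => t.
  by apply: cvgM; [exact: continuous_beta0 | exact: cf].
move=> t _ /=; rewrite lee_fin normrM ler_piMr //.
Qed.

Lemma normr_cos t : `|cos t| <= 1.
Proof. by rewrite ler_norml cos_geN1 cos_le1. Qed.

Lemma normr_sin t : `|sin t| <= 1.
Proof. by rewrite ler_norml sin_geN1 sin_le1. Qed.

Lemma continuous_cosM w : continuous (fun t : R => cos (w * t)).
Proof.
move=> t; apply: continuous_comp; last exact: continuous_cos.
by apply: cvgM; [exact: cvg_cst | exact: cvg_id].
Qed.

Lemma continuous_sinM w : continuous (fun t : R => sin (w * t)).
Proof.
move=> t; apply: continuous_comp; last exact: continuous_sin.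
by apply: cvgM; [exact: cvg_cst | exact: cvg_id].
Qed.

(** Since [beta0] is even, the sine part of its Fourier transform vanishes ([cintegral_beta0_cis])
    and the cosine integral is the whole transform. *)
Definition beta0_hat w : R := \int[mu]_t (beta0 t * cos (w * t)).

Lemma beta0_hat0 : beta0_hat 0 = 1.
Proof.
rewrite /beta0_hat /Rintegral -[RHS]/(fine 1%E) -integral_beta0.
by congr fine; apply: eq_integral => t _; rewrite mul0r cos0 mulr1.
Qed.

(** [beta0] dominates the integrand for every w. Continuity at 0 is what the repeated halving in
    [beta0_hatE] consumes. *)
Lemma continuous_beta0_hat0 : {for 0, continuous beta0_hat}.
Proof.
have cui := @continuity_under_integral R _ _ mu (fun w t => beta0 t * cos (w * t))
  setT measurableT (-1) 1 _ _ (@beta0 R) integrable_beta0 _.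
apply: cui.
- move=> w _; apply: integrable_beta0M; first exact: continuous_cosM.
  by move=> t; exact: normr_cos.
- apply/aeW => t _ w _; apply: cvgM; first exact: cvg_cst.
  under eq_fun do rewrite mulrC.
  by rewrite mulrC; exact: continuous_cosM.
- move=> w _; apply/aeW => t _.
  by rewrite normrM (ger0_norm (beta0_ge0 _)) ler_piMr ?beta0_ge0 ?normr_cos.
- by rewrite inE /= in_itv /=; apply/andP; split; lra.
Qed.

(** The contour shift is carried out on bounded segments; [n.+1] keeps the half-length positive and
    invertible. *)
Lemma cvg_integral_truncated (f : R -> R) : mu.-integrable setT (EFin \o f) ->
  \int[mu]_(t in `[- n.+1%:R, n.+1%:R]) f t @[n --> \oo] --> \int[mu]_t f t.
Proof.
move=> intf; have mf : measurable_fun setT f.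
  by case/integrableP: intf => /measurable_EFinP.
under eq_fun do rewrite Rintegral_mkcond.
apply: fine_cvg; rewrite fineK; last exact: integrable_fin_num.
apply: (@dominated_cvg _ _ _ mu setT measurableT
  (fun n t => ((f \_ `[- n.+1%:R, n.+1%:R]) t)%:E) _ (fun t => `|f t|%:E)) => //=.
- move=> n; apply/measurable_EFinP; apply/(measurable_restrictT _ _).1 => //.
  exact: measurable_funS mf.
- move=> t _; apply: cvg_near_cst; near=> n.
  rewrite patchE mem_set //= in_itv /= -ler_norml.
  apply: (@le_trans _ _ n%:R); last by rewrite ler_nat.
  near: n; exact: nbhs_infty_ger.
- exact: integrable_norm.
- move=> n t _; rewrite lee_fin patchE; case: ifP => // _.
  by rewrite normr0.
Unshelve. all: end_near. Qed.


End LogisticDensity.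

(** * Cauchy-Riemann equations for the extension of [beta0] to a strip *)

Section CauchyRiemann.
Context {R : realType}.
Local Open Scope classical_set_scope.
Local Open Scope ring_scope.
Implicit Types (t w y : R).
Context (ch sh cs sn : R -> R).
Context (dch : forall t, is_derive t 1 ch (pi * sh t)).
Context (dsh : forall t, is_derive t 1 sh (pi * ch t)).
Context (dcs : forall y, is_derive y 1 cs (- pi * sn y)).
Context (dsn : forall y, is_derive y 1 sn (pi * cs y)).
Context (ch2 : forall t, ch t ^+ 2 = 1 + sh t ^+ 2).
Context (sn2 : forall y, sn y ^+ 2 = 1 - cs y ^+ 2).

(* With ch, sh = cosh, sinh (pi t) and cs, sn = cos, sin (pi y), the extension of
   beta0 to the strip is beta0 (t - i y) = strip_re y t + i strip_im y t, and
   beta0 (z) exp (i w z) at z = t - i y is strip_cos w y t + i strip_sin w y t.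
   The four functions are kept abstract so that the inference of derivatives
   does not unfold them. *)
Definition strip_den y t : R := ch t + cs y.

Definition strip_re y t : R := pi / 2 * ((1 + ch t * cs y) * (strip_den y t)^-1 ^+ 2).
Definition strip_im y t : R := pi / 2 * (sh t * sn y * (strip_den y t)^-1 ^+ 2).
(** In z = t - i y the Cauchy-Riemann equations read d_y re = d_t im and d_y im = - d_t re.
    [strip_dre] is the common value in the first one, [strip_dim] is d_t re. The powers of
    [strip_den] arise because the squared modulus of 1 + cosh (pi z) is [strip_den y t ^+ 2]. *)
Definition strip_dre y t : R :=
  pi ^+ 2 / 2 * (sn y * (2 + ch t * cs y - ch t ^+ 2) * (strip_den y t)^-1 ^+ 3).
Definition strip_dim y t : R :=
  pi ^+ 2 / 2 * (sh t * (cs y ^+ 2 - ch t * cs y - 2) * (strip_den y t)^-1 ^+ 3).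

Lemma is_derive_strip_re_y y t : strip_den y t != 0 -> is_derive y 1 (strip_re^~ t) (strip_dre y t).
Proof.
move=> D0; rewrite /strip_re /strip_dre; apply: is_derive_eq.
rewrite /GRing.scale /=; move: D0; rewrite /strip_den => D0.
by field.
Qed.

Lemma is_derive_strip_im_y y t : strip_den y t != 0 -> is_derive y 1 (strip_im^~ t) (- strip_dim y t).
Proof.
move=> D0; rewrite /strip_im /strip_dim; apply: is_derive_eq.
rewrite /GRing.scale /=; move: D0; rewrite /strip_den => D0.
have E := sn2 y; by field: E.
Qed.

Lemma is_derive_strip_re_t y t : strip_den y t != 0 -> is_derive t 1 (strip_re y) (strip_dim y t).
Proof.
move=> D0; rewrite /strip_re /strip_dim; apply: is_derive_eq.
rewrite /GRing.scale /=; move: D0; rewrite /strip_den => D0.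
by field.
Qed.

Lemma is_derive_strip_im_t y t : strip_den y t != 0 -> is_derive t 1 (strip_im y) (strip_dre y t).
Proof.
move=> D0; rewrite /strip_im /strip_dre; apply: is_derive_eq.
rewrite /GRing.scale /=; move: D0; rewrite /strip_den => D0.
have E := ch2 t; by field: E.
Qed.

Definition strip_cos w y t : R := expR (w * y) * (strip_re y t * cos (w * t) - strip_im y t * sin (w * t)).
Definition strip_sin w y t : R := expR (w * y) * (strip_re y t * sin (w * t) + strip_im y t * cos (w * t)).
Definition strip_diff w y t : R := expR (w * y) *
  (w * (strip_re y t * cos (w * t) - strip_im y t * sin (w * t)) +
   (strip_dre y t * cos (w * t) + strip_dim y t * sin (w * t))).

Lemma is_derive_strip_cos_y w y t : strip_den y t != 0 -> is_derive y 1 ((strip_cos w)^~ t) (strip_diff w y t).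
Proof.
move=> D0; have dA := is_derive_strip_re_y D0; have dB := is_derive_strip_im_y D0.
rewrite /strip_cos /strip_diff; apply: is_derive_eq.
by rewrite /GRing.scale /=; ring.
Qed.

Lemma is_derive_strip_sin_t w y t : strip_den y t != 0 -> is_derive t 1 (strip_sin w y) (strip_diff w y t).
Proof.
move=> D0; have dA := is_derive_strip_re_t D0; have dB := is_derive_strip_im_t D0.
rewrite /strip_sin /strip_diff; apply: is_derive_eq.
by rewrite /GRing.scale /=; ring.
Qed.


Lemma continuous_strip_cos w y : (forall t, strip_den y t != 0) -> continuous (strip_cos w y).
Proof.
move=> Dy t; apply/differentiable_continuous/derivable1_diffP.
have D0 := Dy t; have dA := is_derive_strip_re_t D0; have dB := is_derive_strip_im_t D0.
by rewrite /strip_cos; apply: ex_derive.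
Qed.

Lemma continuous_strip_diff w y : (forall t, strip_den y t != 0) -> continuous (strip_diff w y).
Proof.
move=> Dy t; apply/differentiable_continuous/derivable1_diffP.
have D0 := Dy t; have dA := is_derive_strip_re_t D0; have dB := is_derive_strip_im_t D0.
by rewrite /strip_diff /strip_dre /strip_dim; apply: ex_derive.
Qed.

End CauchyRiemann.

(** * The contour shift and the closed form of [beta0_hat] *)

Section LogisticFourier.
Context {R : realType}.
Local Open Scope classical_set_scope.
Local Open Scope ring_scope.
Implicit Types (s t w y T : R).
Local Notation mu := (@lebesgue_measure R).

Let ch t : R := cosh (pi * t).
Let sh t : R := sinh (pi * t).
Let cs y : R := cos (pi * y).
Let sn y : R := sin (pi * y).

Let dch t : is_derive t 1 ch (pi * sh t).
Proof.
rewrite /ch /sh; have dc := is_derive_cosh (pi * t).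
apply: (@is_derive_eq _ _ _ (cosh \o (fun t => pi * t))).
by rewrite /GRing.scale /=; ring.
Qed.

Let dsh t : is_derive t 1 sh (pi * ch t).
Proof.
rewrite /ch /sh; have dc := is_derive_sinh (pi * t).
apply: (@is_derive_eq _ _ _ (sinh \o (fun t => pi * t))).
by rewrite /GRing.scale /=; ring.
Qed.

Let dcs y : is_derive y 1 cs (- pi * sn y).
Proof.
rewrite /cs /sn; apply: is_derive_eq.
by rewrite /GRing.scale /=; ring.
Qed.

Let dsn y : is_derive y 1 sn (pi * cs y).
Proof.
rewrite /cs /sn; apply: is_derive_eq.
by rewrite /GRing.scale /=; ring.
Qed.

Let ch_gt0 t : 0 < ch t. Proof. exact: cosh_gt0. Qed.
Let ch_ge1 t : 1 <= ch t. Proof. exact: cosh_ge1. Qed.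
Let sh_le t : `|sh t| <= ch t. Proof. exact: normr_sinh. Qed.

Let ch2 t : ch t ^+ 2 = 1 + sh t ^+ 2. Proof. exact: sqr_cosh. Qed.

Let sn2 y : sn y ^+ 2 = 1 - cs y ^+ 2.
Proof. by rewrite /sn /cs -(cos2Dsin2 (pi * y)) addrC addKr. Qed.

Let cs_le y : `|cs y| <= 1. Proof. exact: normr_cos. Qed.
Let sn_le y : `|sn y| <= 1. Proof. exact: normr_sin. Qed.

Let D := strip_den ch cs.
Let A := strip_re ch cs.
Let B := strip_im ch sh cs sn.
Let g := strip_cos ch sh cs sn.
Let h := strip_sin ch sh cs sn.
Let k := strip_diff ch sh cs sn.

(** An open neighborhood of [0, 1/2], the range of the shift, at positive distance from the poles at
    y = 1 and y = -1; hence the uniform bound [strip_gap] on the denominator. *)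
Let I : interval R := `]- 4^-1, 3 / 4[.

Let strip_gap : R := 1 + cos (pi * (3 / 4)).

Let strip_gap_gt0 : 0 < strip_gap.
Proof.
rewrite /strip_gap -ltrBlDl sub0r -cospi.
have p0 := pi_gt0 R.
by rewrite ltr_cos ?in_itv /= ?lexx ?(ltW p0) //; [lra|apply/andP; split; lra].
Qed.

Let D_ge y t : y \in I -> strip_gap <= D y t.
Proof.
rewrite in_itv /= => /andP[y1 y2].
have p0 := pi_gt0 R.
rewrite /D /strip_den lerD // ?cosh_ge1 // /cs.
have -> : cos (pi * y) = cos (pi * `|y|).
  by have [_|_] := ger0P y => //; rewrite mulrN cosN.
have yb : `|y| <= 3 / 4 by rewrite ler_norml; apply/andP; split; lra.
rewrite leNgt ltr_cos ?in_itv /=.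
- by rewrite -leNgt; nra.
- by have := normr_ge0 y => ?; apply/andP; split; nra.
- by have := normr_ge0 y => ?; apply/andP; split; nra.
Qed.

Let D_neq0 y t : y \in I -> D y t != 0.
Proof. by move=> /D_ge/(lt_le_trans strip_gap_gt0)/gt_eqF ->. Qed.


(** Differentiation under the integral needs a bound uniform in y. Stability under sums, opposites
    and products lets the bound on [k] follow the shape of its formula. *)
Let bounded_strip T (f : R -> R -> R) :=
  exists M : R, forall y t, y \in I -> t \in `[- T, T] -> `|f y t| <= M.

Let bstripD T f1 f2 : bounded_strip T f1 -> bounded_strip T f2 ->
  bounded_strip T (fun y t => f1 y t + f2 y t).
Proof.
move=> [M1 b1] [M2 b2]; exists (M1 + M2) => y t yI tT.
by rewrite (le_trans (ler_normD _ _)) // lerD ?b1 ?b2.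
Qed.

Let bstripM T f1 f2 : bounded_strip T f1 -> bounded_strip T f2 ->
  bounded_strip T (fun y t => f1 y t * f2 y t).
Proof.
move=> [M1 b1] [M2 b2]; exists (M1 * M2) => y t yI tT.
by rewrite normrM ler_pM ?b1 ?b2.
Qed.

Let bstripN T f1 : bounded_strip T f1 -> bounded_strip T (fun y t => - f1 y t).
Proof. by move=> [M1 b1]; exists M1 => y t yI tT; rewrite normrN b1. Qed.

Let bstrip_cst T c : bounded_strip T (fun _ _ => c).
Proof. by exists `|c|. Qed.

Let bstrip_cos T w : bounded_strip T (fun _ t => cos (w * t)).
Proof. by exists 1 => y t _ _; exact: normr_cos. Qed.

Let bstrip_sin T w : bounded_strip T (fun _ t => sin (w * t)).
Proof. by exists 1 => y t _ _; exact: normr_sin. Qed.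

Let bstrip_cs T : bounded_strip T (fun y _ => cs y).
Proof. by exists 1 => y t _ _; exact: normr_cos. Qed.

Let bstrip_sn T : bounded_strip T (fun y _ => sn y).
Proof. by exists 1 => y t _ _; exact: normr_sin. Qed.

Let bstrip_ch T : bounded_strip T (fun _ t => ch t).
Proof.
exists (expR (pi * T)) => y t _; rewrite in_itv /= => /andP[t1 t2].
rewrite ger0_norm ?(ltW (ch_gt0 _)) // /ch /cosh.
have p0 := pi_gt0 R.
have e1 : expR (pi * t) <= expR (pi * T) by rewrite ler_expR; nra.
have e2 : expR (- (pi * t)) <= expR (pi * T) by rewrite ler_expR; nra.
lra.
Qed.

Let bstrip_sh T : bounded_strip T (fun _ t => sh t).
Proof.
have [M b] := bstrip_ch T; exists M => y t yI tT.
rewrite (le_trans (sh_le t)) // -[leLHS]ger0_norm ?(ltW (ch_gt0 _)) //.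
exact: (b y).
Qed.

Let bstrip_expR T w : bounded_strip T (fun y _ => expR (w * y)).
Proof.
exists (expR `|w|) => y t; rewrite in_itv /= => /andP[y1 y2] _.
rewrite ger0_norm ?expR_ge0 // ler_expR (le_trans (ler_norm _)) // normrM.
rewrite ler_piMr // ler_norml; apply/andP; split; lra.
Qed.

Let bstrip_den T : bounded_strip T (fun y t => (D y t)^-1).
Proof.
exists strip_gap^-1 => y t yI _; have dD := D_ge t yI.
rewrite ger0_norm ?invr_ge0 ?(le_trans (ltW strip_gap_gt0)) //.
by rewrite lef_pV2 // posrE // (lt_le_trans strip_gap_gt0).
Qed.

Let bstrip_k T w : bounded_strip T (k w).
Proof.
have cst c := bstrip_cst T c.
have c := bstrip_ch T; have s := bstrip_sh T.
have cy := bstrip_cs T; have sy := bstrip_sn T.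
have d1 := bstrip_den T; have d2 := bstripM d1 d1; have d3 := bstripM d1 d2.
have bA : bounded_strip T A.
  exact: bstripM (cst _) (bstripM (bstripD (cst 1) (bstripM c cy)) d2).
have bB : bounded_strip T B.
  exact: bstripM (cst _) (bstripM (bstripM s sy) d2).
have bA1 : bounded_strip T (strip_dre ch cs sn).
  apply: bstripM (cst _) (bstripM (bstripM sy _) d3).
  exact: bstripD (bstripD (cst 2) (bstripM c cy)) (bstripN (bstripM c c)).
have bA2 : bounded_strip T (strip_dim ch sh cs).
  apply: bstripM (cst _) (bstripM (bstripM s _) d3).
  exact: bstripD (bstripD (bstripM cy cy) (bstripN (bstripM c cy))) (bstripN (cst 2)).
have co := bstrip_cos T w; have si := bstrip_sin T w.
apply: bstripM (bstrip_expR T w) (bstripD (bstripM (cst w) _) _).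
  exact: bstripD (bstripM bA co) (bstripN (bstripM bB si)).
exact: bstripD (bstripM bA1 co) (bstripM bA2 si).
Qed.

Let V w T y : R := \int[mu]_(t in `[- T, T]) g w y t.

Let int_segment T (f : R -> R) : continuous f ->
  mu.-integrable `[- T, T] (EFin \o f).
Proof.
move=> cf; apply: continuous_compact_integrable; first exact: segment_compact.
exact: continuous_subspaceT.
Qed.

Let cont_g w y : y \in I -> continuous (g w y).
Proof.
move=> yI.
exact: (@continuous_strip_cos R ch sh cs sn dch dsh ch2 w y (fun t => D_neq0 t yI)).
Qed.

Let cont_k w y : y \in I -> continuous (k w y).
Proof.
move=> yI.
exact: (@continuous_strip_diff R ch sh cs sn dch dsh ch2 w y (fun t => D_neq0 t yI)).
Qed.

(** Differentiating under the integral gives the integral of [k w y], which by Cauchy-Riemann is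
    also the t-derivative of [h w y]. Only boundary terms at T and -T remain: the contributions of
    the two vertical sides of the contour. *)
Let dV w T y : 0 < T -> y \in I -> is_derive y 1 (V w T) (h w y T - h w y (- T)).
Proof.
move=> T0 yI.
have dg z t : z \in I -> is_derive z 1 ((g w)^~ t) (k w z t).
  by move=> zI; exact: (@is_derive_strip_cos_y R ch sh cs sn dcs dsn sn2 w z t (D_neq0 t zI)).
have dh t : is_derive t 1 (h w y) (k w y t).
  exact: (@is_derive_strip_sin_t R ch sh cs sn dch dsh ch2 w y t (D_neq0 t yI)).
have p1 z t : z \in I -> partial1of2 (g w) z t = k w z t.
  by move=> zI; rewrite partial1of2E; have [_ ->] := dg z t zI.
have [M bM] := bstrip_k T w.
have intg z : `]- 4^-1, 3 / 4[%classic z -> mu.-integrable `[- T, T] (EFin \o g w z).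
  by move=> zI; apply: int_segment; exact: cont_g.
have derg z t : `]- 4^-1, 3 / 4[%classic z -> `[- T, T]%classic t ->
    derivable ((g w)^~ t) z 1.
  by move=> zI _; have [] := dg z t zI.
have intM : mu.-integrable `[- T, T] (EFin \o (fun _ : R => `|M|)).
  by apply: int_segment => ?; exact: cvg_cst.
have leM z t : `]- 4^-1, 3 / 4[%classic z -> `[- T, T]%classic t ->
    `|partial1of2 (g w) z t| <= `|M|.
  by move=> zI tT; rewrite p1 // (le_trans (bM _ _ zI tT)) // ler_norm.
have mI : measurable (`[- T, T] : set R) by exact: measurable_itv.
apply: DeriveDef.
  have := @derivable_under_integral R _ _ mu (g w) _ mI y _ _ yI intg derg _ (fun=> normr_ge0 M) intM leM.
  exact.
rewrite -derive1E.
rewrite (@differentiation_under_integral R _ _ mu (g w) _ mI y _ _ yI intg derg _ (fun=> normr_ge0 M) intM leM).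
suff fe : integral mu `[- T, T] (fun t => (partial1of2 (g w) y t)%:E) =
    ((h w y T)%:E - (h w y (- T))%:E)%E by rewrite /Rintegral fe.
rewrite -(@continuous_FTC2 _ (k w y) (h w y)).
- by apply: eq_integral => t _; rewrite p1.
- lra.
- exact/continuous_subspaceT/cont_k.
- have ch' t : h w y z @[z --> t] --> h w y t.
    by apply/differentiable_continuous/derivable1_diffP; have [] := dh t.
  split.
  + by move=> t _; have [] := dh t.
  + exact/cvg_at_right_filter/ch'.
  + exact/cvg_at_left_filter/ch'.
- by move=> t _; rewrite derive1E; have [] := dh t.
Qed.

Let cs_ge0 y : 0 <= y <= 2^-1 -> 0 <= cs y.
Proof.
have p0 := pi_gt0 R => /andP[y0 y1].
by rewrite /cs cos_ge0_pihalf //; apply/andP; split; nra.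
Qed.

(** For y up to 1/2, [cs y] is nonnegative, so the denominator is at least [ch t]; the numerators
    are of order [ch t] and the denominator is squared, which leaves decay 1 / ch t. The vertical
    sides therefore vanish in the limit. *)
Let h_le w y t : 0 <= y <= 2^-1 -> `|h w y t| <= expR `|w| * (2 * pi / ch t).
Proof.
move=> y01; have c0 := cs_ge0 y01; have /andP[y0 y1] := y01.
have p0 := pi_gt0 R; have h0 := ch_gt0 t; have h1 := ch_ge1 t.
have D1 : (D y t)^-1 <= (ch t)^-1.
  by rewrite lef_pV2 ?posrE // /D /strip_den; lra.
have D0 : 0 <= (D y t)^-1 by rewrite invr_ge0 /D /strip_den; lra.
have D2 : (D y t)^-1 ^+ 2 <= (ch t)^-1 ^+ 2 by rewrite ler_sqr // nnegrE invr_ge0 ltW.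
have c1 : cs y <= 1 by rewrite (le_trans (ler_norm _)).
have hA : `|A y t| <= pi / ch t.
  rewrite /A /strip_re -/D ger0_norm; last first.
    by rewrite !mulr_ge0 ?exprn_ge0 //; nra.
  rewrite (@le_trans _ _ (pi / 2 * ((2 * ch t) * (ch t)^-1 ^+ 2))) //.
    rewrite ler_pM2l ?divr_gt0 // ler_pM ?exprn_ge0 //; nra.
  by rewrite le_eqVlt; apply/orP; left; apply/eqP; field; rewrite gt_eqF.
have hB : `|B y t| <= pi / ch t.
  rewrite /B /strip_im -/D.
  have -> : `|pi / 2 * (sh t * sn y * (D y t)^-1 ^+ 2)| =
      pi / 2 * (`|sh t| * `|sn y| * (D y t)^-1 ^+ 2).
    rewrite normrM ger0_norm ?divr_ge0 ?(ltW p0) //; congr (_ * _).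
    by rewrite normrM [X in _ * X]ger0_norm ?exprn_ge0 // -[in RHS]normrM.
  rewrite (@le_trans _ _ (pi / 2 * ((ch t * 1) * (ch t)^-1 ^+ 2))) //.
    rewrite ler_pM2l ?divr_gt0 // ler_pM ?mulr_ge0 ?exprn_ge0 //.
    exact: (ler_pM (normr_ge0 _) (normr_ge0 _) (sh_le t) (sn_le y)).
  rewrite (_ : _ * _ = pi / ch t / 2); last by field; rewrite gt_eqF.
  by rewrite ler_pdivrMr // ler_peMr ?ler1n // divr_ge0 // ltW.
rewrite /h /strip_sin -/(A y t) -/(B y t).
move: hA hB; move: (A y t) (B y t) => a b hA hB.
rewrite normrM ler_pM //.
  rewrite ger0_norm ?expR_ge0 // ler_expR (le_trans (ler_norm _)) // normrM.
  rewrite ler_piMr // ler_norml; apply/andP; split; lra.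
rewrite (le_trans (ler_normD _ _)) // !normrM.
rewrite (@le_trans _ _ (`|a| * 1 + `|b| * 1)) //.
  by rewrite lerD // ler_wpM2l // ?normr_cos ?normr_sin.
lra.
Qed.

Let inI y : 0 <= y <= 2^-1 -> y \in I.
Proof. by move=> /andP[? ?]; rewrite in_itv /=; apply/andP; split; lra. Qed.

Let V_diff w n : `|V w n.+1%:R 2^-1 - V w n.+1%:R 0| <= (4 * pi * expR `|w|) * n.+1%:R^-1.
Proof.
have T0 : 0 < n.+1%:R :> R by rewrite ltr0n.
set T : R := n.+1%:R in T0 *.
have in01 (c : R) : c \in `]0, 2^-1[ -> 0 <= c <= 2^-1.
  by rewrite in_itv /= => /andP[? ?]; apply/andP; split; lra.
have [] := @MVT R (V w T) (fun y => h w y T - h w y (- T)) 0 2^-1.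
- by rewrite invr_gt0.
- by move=> y /in01 /inI yI; exact: dV.
- apply: derivable_within_continuous => y.
  rewrite in_itv /= => /inI yI.
  by have [] := dV w T0 yI.
move=> c /in01 c01 ->.
have chN : ch (- T) = ch T by rewrite /ch /cosh mulrN opprK addrC.
have hT := h_le w T c01; have hN := h_le w (- T) c01; rewrite chN in hN.
have p0 := pi_gt0 R.
(* From ch T >= exp (pi T) / 2 >= (1 + pi T) / 2 >= T / 2. Exponential decay is given up for a
   harmonic bound, which suffices. *)
have chT : (ch T)^-1 <= 2 / T.
  have -> : 2 / T = (T / 2)^-1 by field; rewrite gt_eqF.
  rewrite lef_pV2 ?posrE ?(ch_gt0 T) ?divr_gt0 // /ch /cosh.
  have := expR_ge1Dx (pi * T); have := expR_gt0 (- (pi * T)).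
  have : 1 <= pi :> R by have := pi_ge2 R; lra.
  by nra.
rewrite subr0 normrM (ger0_norm (_ : 0 <= 2^-1)) //.
have hh := le_trans (ler_normB _ _) (lerD hT hN).
apply: le_trans (ler_wpM2r _ hh) _ => //.
have e0 := expR_gt0 `|w|.
have -> : (expR `|w| * (2 * pi / ch T) + expR `|w| * (2 * pi / ch T)) * 2^-1 =
    2 * pi * expR `|w| * (ch T)^-1 by field; rewrite gt_eqF // ch_gt0.
have -> : 4 * pi * expR `|w| * T^-1 = 2 * pi * expR `|w| * (2 / T).
  by field; rewrite gt_eqF.
by rewrite ler_wpM2l // !mulr_ge0 // ltW.
Qed.

Let V0 w n : V w n.+1%:R 0 = \int[mu]_(t in `[- n.+1%:R, n.+1%:R]) (beta0 t * cos (w * t)).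
Proof.
apply: eq_Rintegral => t _.
rewrite /g /strip_cos /strip_re /strip_im /strip_den /cs /sn !mulr0 sin0 cos0 expR0.
rewrite /beta0 -/(ch t); have := ch_gt0 t; move: (ch t) => c c0; field.
by rewrite gt_eqF // addr_gt0.
Qed.

(** The half-angle formula cosh (2 x) + 1 = 2 cosh^2 x. The right side is the real part of the
    extension on the line y = 1/2, where [cs] vanishes. *)
Let beta02 t : 2 * beta0 (2 * t) = pi / 2 / ch t ^+ 2.
Proof.
have -> : ch t ^+ 2 = (cosh (pi * (2 * t)) + 1) / 2.
  rewrite /ch /cosh mulrCA -[2 * (pi * t)]/(2%:R * _) mulr_natl mulr2n opprD !expRD expRN.
  by field; rewrite gt_eqF ?expR_gt0.
rewrite /beta0 invfM invrK; have := cosh_gt0 (pi * (2 * t)); move: (cosh _) => c c0; field.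
by rewrite gt_eqF // addr_gt0.
Qed.

Let Vhalf w n : expR (- (w / 2)) * V w n.+1%:R 2^-1 + expR (w / 2) * V (- w) n.+1%:R 2^-1 =
  2 * \int[mu]_(t in `[- n.+1%:R, n.+1%:R]) (2 * beta0 (2 * t) * cos (w * t)).
Proof.
have hI : 2^-1 \in I by apply: inI; rewrite lexx andbT invr_ge0.
have ig v := int_segment n.+1%:R (@cont_g v _ hI).
have mI : measurable (`[- n.+1%:R, n.+1%:R] : set R) by exact: measurable_itv.
have cb : continuous (fun t => 2 * beta0 (2 * t) * cos (w * t)).
  move=> t; apply: cvgM; last exact: continuous_cosM.
  apply: cvgM; first exact: cvg_cst.
  apply: continuous_comp; last exact: continuous_beta0.
  by apply: cvgM; [exact: cvg_cst | exact: cvg_id].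
rewrite /V -!RintegralZl //; last by apply: int_segment.
have cZ c v : continuous (fun t => c * g v 2^-1 t).
  by move=> t; apply: cvgM; [exact: cvg_cst | exact: cont_g].
rewrite -RintegralD //; [|exact: int_segment..].
apply: eq_Rintegral => t _.
have c0 : cs 2^-1 = 0 by rewrite /cs cos_pihalf.
rewrite beta02 /g /strip_cos /strip_re /strip_im /strip_den c0 !(mulNr w) cosN sinN.
rewrite !addr0 mulr0 addr0 expRN.
by field; rewrite !gt_eqF ?expR_gt0.
Qed.

Let cvgV w : V w n.+1%:R 2^-1 @[n --> \oo] --> beta0_hat w.
Proof.
have -> : (fun n => V w n.+1%:R 2^-1) =
   (fun n => V w n.+1%:R 0 + (V w n.+1%:R 2^-1 - V w n.+1%:R 0)).
  by apply/funext => n; rewrite addrC subrK.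
rewrite -[beta0_hat w]addr0; apply: cvgD.
  under eq_fun do rewrite V0.
  apply: cvg_integral_truncated; apply: integrable_beta0M.
    exact: continuous_cosM.
  by move=> t; exact: normr_cos.
apply: norm_cvg0.
apply: (@squeeze_cvgr _ _ _ _ (fun=> 0) (fun n => (4 * pi * expR `|w|) * n.+1%:R^-1)).
- by apply: nearW => n; rewrite normr_ge0 V_diff.
- exact: cvg_cst.
- rewrite -(mulr0 (4 * pi * expR `|w|)); apply: cvgM; first exact: cvg_cst.
  exact: cvg_harmonic.
Qed.

Let beta0_hatN w : beta0_hat (- w) = beta0_hat w.
Proof. by apply: eq_Rintegral => t _; rewrite mulNr cosN. Qed.

Let ge0_dilate (f : R -> R) : continuous f -> (forall t, 0 <= f t) ->
  (\int[mu]_t (f t)%:E = \int[mu]_t (2 * f (2 * t))%:E)%E.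
Proof.
move=> cf f0.
have d2 : (fun t : R => 2 * t)^`()%classic = cst 2.
  apply/funext => t; rewrite derive1E.
  have [] : is_derive t 1 (fun t : R => 2 * t) 2 => //.
  by apply: is_derive_eq; rewrite /GRing.scale /=; ring.
rewrite (@increasing_ge0_integration_by_substitutionT _ (fun t : R => 2 * t) f) //.
- by apply: eq_integral => t _; rewrite d2 /= fctE mulrC.
- by move=> x y xy; rewrite ltr_pM2l.
- by rewrite d2 => t; exact: cvg_cst.
- by rewrite d2; exact: is_cvg_cst.
- by rewrite d2; exact: is_cvg_cst.
- apply/cvgrNyPle => a; near=> x.
  have : x <= a / 2 by near: x; apply: nbhs_ninfty_le; rewrite num_real.
  lra.
- apply/cvgryPge => a; near=> x.
  have : a / 2 <= x by near: x; apply: nbhs_pinfty_ge; rewrite num_real.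
  lra.
Unshelve. all: end_near. Qed.

Let integrable_dilate (f : R -> R) : continuous f -> (forall t, 0 <= f t) ->
  mu.-integrable setT (EFin \o f) ->
  mu.-integrable setT (EFin \o (fun t => 2 * f (2 * t))).
Proof.
move=> cf f0 /integrableP[mf If]; apply/integrableP; split.
  apply/measurable_EFinP; apply: continuous_measurable_fun => t.
  apply: cvgM; first exact: cvg_cst.
  apply: continuous_comp; last exact: cf.
  by apply: cvgM; [exact: cvg_cst | exact: cvg_id].
apply: le_lt_trans If.
under eq_integral do rewrite /= ger0_norm ?mulr_ge0 //.
under [leRHS]eq_integral do rewrite /= ger0_norm //.
by rewrite -ge0_dilate.
Qed.

Let beta0_hat_dilate w :
  mu.-integrable setT (EFin \o (fun t => 2 * beta0 (2 * t) * cos (w * t))) /\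
  \int[mu]_t (2 * beta0 (2 * t) * cos (w * t)) = beta0_hat (w / 2).
Proof.
(* [ge0_dilate] concerns nonnegative integrands. The signed function beta0 cos is written as the
   difference of beta0 (1 + cos) and beta0, both nonnegative. *)
pose f1 t : R := beta0 t + beta0 t * cos (w / 2 * t).
have icos : mu.-integrable setT (EFin \o (fun t => beta0 t * cos (w / 2 * t))).
  by apply: integrable_beta0M; [exact: continuous_cosM | move=> t; exact: normr_cos].
have i0 := @integrable_beta0 R.
have c1 : continuous f1.
  move=> t; apply: cvgD; first exact: continuous_beta0.
  by apply: cvgM; [exact: continuous_beta0 | exact: continuous_cosM].
have f1_ge0 t : 0 <= f1 t.
  by have := beta0_ge0 t; have := cos_geN1 (w / 2 * t); rewrite /f1; nra.
have i1 : mu.-integrable setT (EFin \o f1).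
  have -> : EFin \o f1 = ((EFin \o (@beta0 R)) \+ (EFin \o (fun t : R => (beta0 t * cos (w / 2 * t))%R)))%E.
    by apply/funext => t; rewrite /f1 /= EFinD.
  exact: integrableD.
have j1 := integrable_dilate c1 f1_ge0 i1.
have j0 := integrable_dilate (@continuous_beta0 R) (@beta0_ge0 R) i0.
have E t : 2 * beta0 (2 * t) * cos (w * t) = 2 * f1 (2 * t) - 2 * beta0 (2 * t).
  rewrite /f1 (_ : w / 2 * (2 * t) = w * t); last by field.
  ring.
split.
  rewrite (_ : EFin \o _ = ((EFin \o (fun t => 2 * f1 (2 * t))%R) \- (EFin \o (fun t => 2 * beta0 (2 * t))%R))%E).
    exact: integrableB.
  by apply/funext => t; rewrite /= E EFinB.
under eq_Rintegral do rewrite E.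
rewrite RintegralB //.
have -> : \int[mu]_t (2 * f1 (2 * t)) = \int[mu]_t f1 t.
  by rewrite /Rintegral -ge0_dilate.
have -> : \int[mu]_t (2 * beta0 (2 * t)) = \int[mu]_t beta0 t.
  by rewrite /Rintegral -(ge0_dilate (@continuous_beta0 R) (@beta0_ge0 R)).
by rewrite RintegralD // addrC addKr.
Qed.

(* Shift of the contour by i/2: on the line y = 1/2 the real part of beta0 is
   2 beta0 (2 t), and the imaginary part cancels between w and - w. *)
Lemma beta0_hat_half w :
  beta0_hat w * (expR (w / 2) + expR (- (w / 2))) = 2 * beta0_hat (w / 2).
Proof.
have [iw <-] := beta0_hat_dilate w.
pose In n := \int[mu]_(t in `[- n.+1%:R, n.+1%:R]) (2 * beta0 (2 * t) * cos (w * t)).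
have r : (2 * In n) @[n --> \oo] --> 2 * \int[mu]_t (2 * beta0 (2 * t) * cos (w * t)).
  by apply: cvgM; [exact: cvg_cst | exact: cvg_integral_truncated].
have l : (expR (- (w / 2)) * V w n.+1%:R 2^-1 + expR (w / 2) * V (- w) n.+1%:R 2^-1)
   @[n --> \oo] --> expR (- (w / 2)) * beta0_hat w + expR (w / 2) * beta0_hat w.
  apply: cvgD; first by apply: cvgM; [exact: cvg_cst | exact: cvgV].
  by apply: cvgM; [exact: cvg_cst | rewrite -(beta0_hatN w); exact: cvgV].
rewrite mulrC mulrDl addrC.
move: l; rewrite (_ : (fun n => _) = (fun n => 2 * In n)) => [l|].
  exact: (cvg_unique _ l r).
by apply/funext => n; exact: Vhalf.
Qed.

(* beta0_hat w * sinh w / w is invariant under w |-> w / 2, and tends to 1 at 0. *)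
Lemma beta0_hatE w : beta0_hat w * (expR w - expR (- w)) = 2 * w.
Proof.
have step n : beta0_hat w * (expR w - expR (- w)) =
   beta0_hat (w / 2 ^+ n) *
     ((expR (w / 2 ^+ n) - expR (- (w / 2 ^+ n))) / (2 ^+ n)^-1).
  elim: n => [|n ->]; first by rewrite expr0 divr1 invr1 divr1.
  set u := w / 2 ^+ n.+1.
  have -> : w / 2 ^+ n = 2 * u by rewrite /u exprS; field; rewrite expf_neq0.
  have := beta0_hat_half (2 * u); rewrite (_ : 2 * u / 2 = u); last by field.
  rewrite !(mulr_natl _ 2) !mulr2n => E.
  have -> : (2 ^+ n.+1)^-1 = (2 ^+ n)^-1 / 2 :> R by rewrite exprS invfM mulrC.
  rewrite [- (u + u)]opprD !expRD.
  transitivity (beta0_hat (u + u) * (expR u + expR (- u)) *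
      (expR u - expR (- u)) / (2 ^+ n)^-1); first by ring.
  by rewrite E !invfM !invrK; ring.
have q0 : ((2 ^+ n)^-1 : R) @[n --> \oo] --> (0 : R).
  under eq_fun do rewrite -exprVn.
  by apply: cvg_expr; rewrite ger0_norm ?invr_ge0 // invf_lt1 // ltr1n.
have l1 : beta0_hat (w / 2 ^+ n) @[n --> \oo] --> (1 : R).
  rewrite -[X in _ --> X]beta0_hat0.
  apply: (continuous_cvg _ continuous_beta0_hat0).
  by rewrite -(mulr0 w); apply: cvgM; [exact: cvg_cst | exact: q0].
(* The second factor in [step] is the difference quotient of [phi] at 0 with increment 2^-n, so it
   tends to phi' 0 = 2 w. *)
pose phi x : R := expR (w * x) - expR (- (w * x)).
have dphi : is_derive (0 : R) 1 phi (2 * w).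
  rewrite /phi; apply: is_derive_eq.
  by rewrite /GRing.scale /= mulr0 oppr0 expR0; ring.
have l2 : ((expR (w / 2 ^+ n) - expR (- (w / 2 ^+ n))) / (2 ^+ n)^-1)
    @[n --> \oo] --> 2 * w.
  have [dd dv] := dphi.
  have dl : (h^-1 *: (phi (h *: 1 + 0) - phi 0)) @[h --> 0^'] --> 2 * w.
    by rewrite -dv; exact: dd.
  have q0' : (forall n, ((2 ^+ n)^-1 : R) != 0) /\
      ((2 ^+ n)^-1 : R) @[n --> \oo] --> (0 : R).
    by split => // n; rewrite invr_neq0 // expf_neq0.
  move/cvgr_dnbhsP/(_ _ q0') : dl.
  rewrite [X in _ -> X @ _ --> _](_ : _ = (fun n : nat => ((2 ^+ n)^-1 : R)^-1 *:
      (phi (((2 ^+ n)^-1 : R) *: (1 : R) + 0) - phi 0))) //.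
  apply/funext => n.
  by rewrite /phi /GRing.scale /= mulr1 addr0 mulr0 oppr0 expR0 subrr subr0 mulrC.
have l : beta0_hat (w / 2 ^+ n) *
    ((expR (w / 2 ^+ n) - expR (- (w / 2 ^+ n))) / (2 ^+ n)^-1)
    @[n --> \oo] --> 2 * w.
  by rewrite -[X in _ --> X]mul1r; exact: cvgM.
move: l; rewrite [X in X @ _ --> _](_ : _ =
  (fun=> beta0_hat w * (expR w - expR (- w)))) => [l|].
  exact: (cvg_unique _ (cvg_cst _) l).
by apply/funext => n; rewrite -step.
Qed.

End LogisticFourier.

(** * Functional calculus *)

Section ComplexScalars.
Context {R : realType}.
Local Open Scope sesquilinear_scope.
Local Notation C := R[i].

Lemma conjCE (z : C) : Num.conj z = conjc z. Proof. by []. Qed.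

Lemma conjC_real (x : R) : Num.conj x%:C = x%:C :> C.
Proof. by rewrite conjCE conjc_real. Qed.

Lemma normc_conj (z : C) : normc (Num.conj z) = normc z.
Proof. by case: z => a b /=; rewrite sqrrN. Qed.

Lemma normc_real (x : R) : normc (x%:C : C) = `|x|.
Proof. by rewrite /= expr0n /= addr0 sqrtr_sqr. Qed.

Lemma normc_ge0 (z : C) : 0 <= normc z.
Proof. by case: z => a b /=; exact: sqrtr_ge0. Qed.

Lemma normr_Re_le (z : C) : `|complex.Re z| <= normc z.
Proof. by case: z => a b /=; rewrite -sqrtr_sqr ler_wsqrtr // lerDl sqr_ge0. Qed.

Lemma normr_Im_le (z : C) : `|complex.Im z| <= normc z.
Proof. by case: z => a b /=; rewrite -sqrtr_sqr ler_wsqrtr // lerDr sqr_ge0. Qed.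

Lemma normc_sum (I : Type) (r : seq I) (P : pred I) (F : I -> C) :
  normc (\sum_(i <- r | P i) F i) <= \sum_(i <- r | P i) normc (F i).
Proof.
elim/big_rec2: _ => [|i y x _ h]; first by rewrite normc0.
by rewrite (le_trans (le_normcD _ _)) // lerD2l.
Qed.

Lemma mul_conjC_normc (z : C) : z * Num.conj z = (normc z ^+ 2)%:C.
Proof.
case: z => a b; rewrite conjCE /= sqr_sqrtr ?addr_ge0 ?sqr_ge0 //.
by simpc; congr (_ +i* _); ring.
Qed.

End ComplexScalars.

(** * Unitary diagonal forms *)

Section DiagonalForm.
Context {C : numClosedFieldType}.
Local Open Scope sesquilinear_scope.

(** The eigenvalues are a plain function, so that products act pointwise and functional calculus is
    composition. The columns of the adjoint of [Q] are the eigenvectors. *)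
Definition conj_diag n (Q : 'M[C]_n) (d : 'I_n -> C) : 'M[C]_n :=
  Q ^t* *m diag_mx (\row_j d j) *m Q.

Lemma conj_diagE n (Q : 'M[C]_n) d p q :
  conj_diag Q d p q = \sum_i Num.conj (Q i p) * d i * Q i q.
Proof.
by rewrite mxE; apply: eq_bigr => i _; rewrite mul_mx_diag !mxE.
Qed.

Lemma eq_conj_diag n (Q : 'M[C]_n) d d' : d =1 d' -> conj_diag Q d = conj_diag Q d'.
Proof.
move=> dd; rewrite /conj_diag; congr (_ *m diag_mx _ *m _).
by apply/rowP => j; rewrite !mxE.
Qed.

Lemma conj_diag_mul n (Q : 'M[C]_n) d d' : Q \is unitarymx ->
  conj_diag Q d *m conj_diag Q d' = conj_diag Q (fun i => d i * d' i).
Proof.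
move=> Qu; rewrite /conj_diag !mulmxA -[_ *m Q *m _]mulmxA (unitarymxP Qu) mulmx1.
rewrite -(mulmxA (Q ^t*) (diag_mx _) (diag_mx _)) mulmx_diag; congr (_ *m diag_mx _ *m _).
by apply/rowP => j; rewrite !mxE.
Qed.

Lemma conj_diag_adj n (Q : 'M[C]_n) d :
  (conj_diag Q d) ^t* = conj_diag Q (fun i => Num.conj (d i)).
Proof.
apply/matrixP => p q; rewrite !mxE rmorph_sum; apply: eq_bigr => i _ /=.
rewrite !mul_mx_diag !mxE !rmorphM /= conjCK mulrC mulrA.
by rewrite mulrAC.
Qed.

Lemma unitarymx_adjM n (Q : 'M[C]_n) : Q \is unitarymx -> Q ^t* *m Q = 1%:M.
Proof. by move=> Qu; apply: mulmx1C; exact/unitarymxP. Qed.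

Lemma conj_diag_comp n (Q V : 'M[C]_n) d :
  Q ^t* *m conj_diag V d *m Q = conj_diag (V *m Q) d.
Proof. by rewrite /conj_diag trmx_mul map_mxM !mulmxA. Qed.

Lemma invmx_conj_diag n (Q : 'M[C]_n) (D : 'rV[C]_n) : Q \is unitarymx ->
  invmx Q *m diag_mx D *m Q = conj_diag Q (D 0).
Proof.
move=> Qu; rewrite invmx_unitary // /conj_diag; congr (_ *m diag_mx _ *m _).
by apply/rowP => j; rewrite !mxE.
Qed.

(** The change of basis W = P Q^* intertwines the two diagonals: s i W i j = W i j d j. Where W i j
    is nonzero, s i = d j and hence r i = e j, so W intertwines [r] and [e] as well. *)
Lemma conj_diag_inj n (Q P : 'M[C]_n) d s e r :
  Q \is unitarymx -> P \is unitarymx -> (forall i j, d j = s i -> e j = r i) ->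
  conj_diag Q d = conj_diag P s -> conj_diag Q e = conj_diag P r.
Proof.
move=> Qu Pu der dsE.
have PQ : diag_mx (\row_j s j) *m (P *m Q ^t*) = P *m Q ^t* *m diag_mx (\row_j d j).
  have := congr1 (fun B => P *m B *m Q ^t*) dsE.
  rewrite /conj_diag !mulmxA (unitarymxP Pu) mul1mx => <-.
  by rewrite mulmxtVK.
have rPQ : diag_mx (\row_j r j) *m (P *m Q ^t*) = P *m Q ^t* *m diag_mx (\row_j e j).
  apply/matrixP => i j; have /matrixP/(_ i j) := PQ.
  rewrite !mul_diag_mx !mul_mx_diag !mxE; set w := \sum_(_ < _) _.
  have [-> _|w0] := eqVneq w 0; first by rewrite mulr0 mul0r.
  by rewrite [w * _]mulrC => /(mulIf w0)/esym/der ->; rewrite mulrC.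
have := congr1 (fun B => P ^t* *m B *m Q) rPQ.
rewrite !mulmxA (unitarymx_adjM Pu) mul1mx /conj_diag => <-.
by rewrite -[_ *m Q ^t* *m Q]mulmxA (unitarymx_adjM Qu) mulmx1.
Qed.

Lemma spectral_conj_diag n (A : 'M[C]_n) : A ^t* = A ->
  A = conj_diag (spectralmx A) (spectral_diag A 0).
Proof.
move=> Ah; rewrite -invmx_conj_diag ?spectral_unitarymx //.
apply/orthomx_spectralP/hermitian_normalmx.
by rewrite is_hermitianmxE expr0 scale1r Ah.
Qed.

Lemma hermitian_diag_real n (A : 'M[C]_n) i : A ^t* = A ->
  spectral_diag A 0 i \is Num.real.
Proof.
move=> Ah; have Ah' : A \is hermsymmx by rewrite is_hermitianmxE expr0 scale1r Ah.
by have /hermitian_spectral_diag_real/mxOverP := Ah'.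
Qed.

Lemma delta_mx_adj n (i : 'I_n) : (delta_mx i 0 : 'cV[C]_n) ^t* = delta_mx 0 i.
Proof.
by apply/matrixP => a b; rewrite !mxE andbC; case: (_ && _); rewrite ?conjC1 ?conjC0.
Qed.

Lemma conj_diag_quad n (Q : 'M[C]_n) d i : Q \is unitarymx ->
  ((Q ^t* *m (delta_mx i 0 : 'cV[C]_n)) ^t* *m conj_diag Q d *m
    (Q ^t* *m (delta_mx i 0 : 'cV[C]_n))) 0 0 = d i.
Proof.
move=> Qu; rewrite trmx_mul map_mxM trmxCK delta_mx_adj /conj_diag !mulmxA.
rewrite -[_ *m Q *m Q ^t*]mulmxA (unitarymxP Qu) mulmx1.
rewrite -[_ *m Q *m Q ^t*]mulmxA (unitarymxP Qu) mulmx1.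
by rewrite -rowE -colE !mxE eqxx mulr1n.
Qed.

(* [A - A^*] is ['i] times a Hermitian matrix whose quadratic form vanishes. *)
Lemma quad_real_adj n (A : 'M[C]_n) :
  (forall v : 'cV[C]_n, (v ^t* *m A *m v) 0 0 \is Num.real) -> A ^t* = A.
Proof.
move=> Areal; apply/esym/eqP; rewrite -subr_eq0.
have i0 : ('i%R : C) != 0 by rewrite neq0Ci.
have adjB (B D : 'M[C]_n) : (B - D) ^t* = B ^t* - D ^t*.
  by apply/matrixP => a b; rewrite !mxE rmorphB.
have hS : ('i%R *: (A - A ^t*)) ^t* = 'i%R *: (A - A ^t*).
  by apply/matrixP => a b; rewrite !mxE rmorphM rmorphB /= conjCK conjCi; ring.
have E := spectral_conj_diag hS; set Q := spectralmx _ in E; set d := spectral_diag _ in E.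
have Qu : Q \is unitarymx by exact: spectral_unitarymx.
have d0 i : d 0 i = 0.
  rewrite -[LHS](conj_diag_quad (d 0) i Qu) -E.
  move: (Q ^t* *m delta_mx i 0) => v.
  rewrite -scalemxAr -scalemxAl mxE mulmxBr mulmxBl mxE.
  rewrite [X in 'i%R * (_ + X)]mxE.
  have -> : (v ^t* *m A ^t* *m v) 0 0 = Num.conj ((v ^t* *m A *m v) 0 0).
    rewrite -[RHS](_ : ((v ^t* *m A *m v) ^t*) 0 0 = _); last by rewrite !mxE.
    by rewrite !trmx_mul !map_mxM trmxCK mulmxA.
  by rewrite (CrealP (Areal v)) subrr mulr0.
suff : 'i%R *: (A - A ^t*) = 0 by move/eqP; rewrite scaler_eq0 (negPf i0).
rewrite E; apply/matrixP => p q; rewrite conj_diagE mxE big1 // => k _.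
by rewrite d0 mulr0 mul0r.
Qed.

End DiagonalForm.

Section FunctionalCalculus.
Context {R : realType}.
Local Open Scope sesquilinear_scope.
Local Notation C := R[i].

Lemma hermitian_conj_diag n (A : 'M[C]_n) : A ^t* = A ->
  exists (Q : 'M[C]_n) (d : 'I_n -> R),
    Q \is unitarymx /\ A = conj_diag Q (fun i => (d i)%:C).
Proof.
move=> Ah; exists (spectralmx A), (fun j => complex.Re (spectral_diag A 0 j)).
split; first exact: spectral_unitarymx.
rewrite {1}(spectral_conj_diag Ah); apply: eq_conj_diag => i.
by rewrite RRe_real // hermitian_diag_real.
Qed.

(* The functional calculus does not depend on the choice of the diagonalization. *)
Lemma mxfun_conj_diag (f : R -> C) n (Q : 'M[C]_n) (d : 'I_n -> R) :
  Q \is unitarymx ->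
  mxfun f (conj_diag Q (fun i => (d i)%:C)) = conj_diag Q (fun i => f (d i)).
Proof.
move=> Qu; set A := conj_diag _ _.
have Ah : A ^t* = A.
  by rewrite conj_diag_adj; apply: eq_conj_diag => i; rewrite conjC_real.
have Pu := spectral_unitarymx A.
rewrite /mxfun (invmx_conj_diag _ Pu); apply/esym.
apply: (conj_diag_inj Qu Pu _ (spectral_conj_diag Ah)) => i j E.
by rewrite mxE -E.
Qed.

Lemma suppmx_conj_diag n (Q : 'M[C]_n) (d : 'I_n -> R) : Q \is unitarymx ->
  suppmx (conj_diag Q (fun i => (d i)%:C)) = conj_diag Q (fun i => (d i != 0)%:R).
Proof. exact: mxfun_conj_diag. Qed.

Lemma mxfun_conj (f : R -> C) n (Q Y : 'M[C]_n) : Q \is unitarymx -> Y ^t* = Y ->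
  mxfun f (Q ^t* *m Y *m Q) = Q ^t* *m mxfun f Y *m Q.
Proof.
move=> Qu /hermitian_conj_diag[V [y [Vu ->]]].
have VQ : V *m Q \is unitarymx := mul_unitarymx Vu Qu.
have e1 := conj_diag_comp Q V (fun i => (y i)%:C).
have e2 := conj_diag_comp Q V (fun i => f (y i)).
by rewrite e1 (mxfun_conj_diag f y VQ) (mxfun_conj_diag f y Vu) e2.
Qed.

Lemma psdmx_adj n (A : 'M[C]_n) : psdmx A -> A ^t* = A.
Proof. by move=> Apsd; apply: quad_real_adj => v; exact: ger0_real (Apsd v). Qed.

Lemma psdmx_conj_diag_ge0 n (Q : 'M[C]_n) (d : 'I_n -> R) : Q \is unitarymx ->
  psdmx (conj_diag Q (fun i => (d i)%:C)) -> forall i, 0 <= d i.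
Proof.
move=> Qu psd i; rewrite -(ler0c (d i)).
by rewrite -[X in _ <= X](conj_diag_quad (fun i => (d i)%:C) i Qu).
Qed.

End FunctionalCalculus.

(** * Derivative of the logarithm *)

Section LogDividedDifference.
Context {R : realType}.
Local Open Scope sesquilinear_scope.
Implicit Types a b y d : R.

Definition ln_divdiff a b : R :=
  if a == b then a^-1 else (ln a - ln b) / (a - b).

Lemma ln_leB1 a : 0 < a -> ln a <= a - 1.
Proof.
move=> a0; rewrite -[leRHS]expRK ler_ln ?posrE ?expR_gt0 //.
by have := expR_ge1Dx (a - 1); rewrite addrC subrK.
Qed.

Lemma lnB_le a y : 0 < a -> 0 < y -> ln y - ln a <= (y - a) / a.
Proof.
move=> a0 y0; rewrite -ln_div ?posrE //.
rewrite (le_trans (ln_leB1 _)) ?divr_gt0 // mulrBl divff ?gt_eqF //.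
Qed.

Lemma ln_lipschitz d a y : 0 < d -> d <= a -> d <= y ->
  `|ln y - ln a| <= d^-1 * `|y - a|.
Proof.
move=> d0 da dy; have a0 := lt_le_trans d0 da; have y0 := lt_le_trans d0 dy.
wlog ay : a y da dy a0 y0 / a <= y => [H|].
  have [|/ltW ya] := leP a y; first exact: H.
  by rewrite distrC (distrC y); exact: H.
rewrite !ger0_norm ?subr_ge0 ?ler_ln ?posrE //.
rewrite (le_trans (lnB_le a0 y0)) // mulrC ler_wpM2r ?subr_ge0 // lef_pV2 ?posrE //.
Qed.

Lemma ln_divdiff_eq a b : ln_divdiff a b * (b - a) = ln b - ln a.
Proof.
rewrite /ln_divdiff; case: eqP => [->|/eqP ab]; first by rewrite !subrr mulr0.
by field; rewrite subr_eq0.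
Qed.

(** The tangents of the concave [ln] at a and at y place the remainder between - (y - a)^2 / (a y)
    and 0. *)
Lemma ln_newton_remainder_diag d a y : 0 < d -> d <= a -> d <= y ->
  `|ln y - ln a - a^-1 * (y - a)| <= (a * d)^-1 * (`|y - a| * `|y - a|).
Proof.
move=> d0 da dy; have a0 := lt_le_trans d0 da; have y0 := lt_le_trans d0 dy.
have h1 := lnB_le a0 y0; have h2 := lnB_le y0 a0.
rewrite ler0_norm; last by rewrite subr_le0 mulrC.
rewrite -normrM -expr2 ger0_norm ?sqr_ge0 //.
have h3 : (y - a) ^+ 2 / (a * y) <= (a * d)^-1 * (y - a) ^+ 2.
  by rewrite mulrC ler_wpM2r ?sqr_ge0 // lef_pV2 ?posrE ?mulr_gt0 // ler_pM2l.
apply: le_trans h3.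
have -> : (y - a) ^+ 2 / (a * y) = a^-1 * (y - a) + (a - y) / y.
  by field; rewrite !gt_eqF.
lra.
Qed.

(* For y <= 0 the bound uses the convention ln y = 0. *)
Lemma ln_newton_remainder d a b : 0 < d -> d <= a -> d <= b ->
  exists2 c, 0 <= c & forall y, (y <= 0) \/ (d <= y) ->
    `|ln y - ln a - ln_divdiff a b * (y - a)| <= c * (`|y - a| * `|y - b|).
Proof.
move=> d0 da db; have a0 := lt_le_trans d0 da; have b0 := lt_le_trans d0 db.
set l := ln_divdiff a b.
(* For y <= 0 the distances to a and b are at least a and b, so the bounded term ln a and the linear
   term are both absorbed by their product. *)
pose c0 := `|ln a| / (a * b) + `|l| / b.
have c00 : 0 <= c0 by rewrite addr_ge0 // divr_ge0 // ?mulr_ge0 // ltW.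
have neg y : y <= 0 -> `|ln y - ln a - l * (y - a)| <= c0 * (`|y - a| * `|y - b|).
  move=> y0; rewrite ln0 // sub0r.
  have na : `|y - a| = a - y by rewrite distrC ger0_norm //; lra.
  have nb : `|y - b| = b - y by rewrite distrC ger0_norm //; lra.
  rewrite (le_trans (ler_normB _ _)) // normrN normrM na nb mulrDl lerD //.
    rewrite mulrAC -mulrA ler_peMr // ler_pdivlMr ?mulr_gt0 // mul1r.
    by rewrite ler_pM //; lra.
  rewrite -mulrA ler_wpM2l // mulrCA ler_peMr ?subr_ge0; [|lra|].
    lra.
  by rewrite ler_pdivlMl // mulr1; lra.
have [ab|ab] := eqVneq a b.
  exists (c0 + (a * d)^-1).
    by rewrite addr_ge0 // invr_ge0 mulr_ge0 // ltW.
  move=> y; rewrite mulrDl => -[/neg h|dy].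
    by rewrite (le_trans h) // lerDl !mulr_ge0 // invr_ge0 mulr_ge0 // ltW.
  rewrite /l /ln_divdiff ab eqxx -ab.
  rewrite (le_trans (ln_newton_remainder_diag d0 da dy)) // lerDr.
  by rewrite !mulr_ge0.
pose c1 := d^-1 + `|l|.
have c10 : 0 <= c1 by rewrite addr_ge0 // invr_ge0 ltW.
have ab0 : 0 < `|a - b| by rewrite normr_gt0 subr_eq0.
(* The remainder r vanishes at both nodes, so r <= c1 |y - a| and r <= c1 |y - b|. Multiplying |a -
   b| <= |y - a| + |y - b| by r gives r |a - b| <= 2 c1 |y - a| |y - b|. *)
exists (c0 + c1 * 2 / `|a - b|).
  by rewrite addr_ge0 // divr_ge0 // mulr_ge0.
move=> y; rewrite mulrDl => -[/neg h|dy].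
  by rewrite (le_trans h) // lerDl !mulr_ge0 // ?invr_ge0 ?mulr_ge0.
rewrite -[leLHS]add0r lerD //; first by rewrite !mulr_ge0.
have lip z : d <= z -> `|ln y - ln z - l * (y - z)| <= c1 * `|y - z|.
  move=> dz; rewrite (le_trans (ler_normB _ _)) // mulrDl normrM lerD //.
  exact: ln_lipschitz.
have ra := lip a da.
have rb : `|ln y - ln a - l * (y - a)| <= c1 * `|y - b|.
  rewrite (_ : ln y - ln a - _ = ln y - ln b - l * (y - b)); first exact: lip.
  have := ln_divdiff_eq a b; rewrite -/l; lra.
set r := `|ln y - _ - _| in ra rb *.
have tri : `|a - b| <= `|y - a| + `|y - b|.
  by rewrite (_ : a - b = (y - b) - (y - a)) ?(le_trans (ler_normB _ _)) 1?addrC //; ring.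
have r0 : 0 <= r by exact: normr_ge0.
rewrite -(ler_pM2r ab0) mulrAC mulfVK ?gt_eqF //.
have h1 := ler_wpM2r (normr_ge0 (y - b)) ra.
have h2 := ler_wpM2r (normr_ge0 (y - a)) rb.
have h3 := ler_wpM2l r0 tri.
apply: le_trans h3 _; rewrite mulrDr; nra.
Qed.

(** The inverse of each positive [x i] is a summand of [s]; adding 1 keeps the witness well defined
    when no [x i] is positive. *)
Lemma common_lower_bound (I : finType) (x : I -> R) :
  exists2 d, 0 < d & forall i, 0 < x i -> d <= x i.
Proof.
pose s := \sum_i `|x i|^-1.
have s0 : 0 <= s by apply: sumr_ge0 => i _; rewrite invr_ge0.
exists (1 + s)^-1; first by rewrite invr_gt0 ltr_pwDl.
move=> i xi; rewrite -[leRHS]invrK lef_pV2 ?posrE ?invr_gt0 ?ltr_pwDl //.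
rewrite /s (bigD1 i) //= gtr0_norm // addrCA lerDl addr_ge0 //.
by apply: sumr_ge0 => j _; rewrite invr_ge0.
Qed.

End LogDividedDifference.

(** * Second-order error of the logarithm near a diagonal matrix *)

Section LogPerturbation.
Context {R : realType}.
Local Open Scope sesquilinear_scope.
Local Notation C := R[i].

Lemma unitarymx_entry_le1 n (V : 'M[C]_n) i j : V \is unitarymx -> normc (V i j) <= 1.
Proof.
move=> Vu; have /matrixP/(_ i i) := unitarymxP Vu; rewrite !mxE eqxx /= => E.
have : (\sum_k normc (V i k) ^+ 2)%:C = 1%:C :> C.
  by rewrite rmorph_sum /=; apply: etrans E; apply: eq_bigr => k _; rewrite !mxE mul_conjC_normc.
move=> /complexI S; rewrite -(@ler_sqr _ (normc _) 1) ?nnegrE ?normc_ge0 // expr1n -S.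
by rewrite (bigD1 j) //= lerDl sumr_ge0 // => k _; rewrite sqr_ge0.
Qed.

(* If y and V are the eigenvalues and eigenvectors of diag x + t K, the error is
   sum_j conj (V j i) V j k r (y j) with r the remainder of the interpolation of ln
   at x i and x k. Since |V j i| |y j - x i| = O(t), it is O(t^2); for small t no
   y j lies in ]0, d[, where ln is not controlled. *)
Lemma ln_perturbation n (x : 'I_n -> R) (K : 'M[C]_n) :
  (forall i, 0 <= x i) -> K ^t* = K ->
  (forall i k, x i = 0 -> K i k = 0) ->
  exists M e : R, 0 < e /\ forall t : R, `|t| < e -> forall i k,
    normc (mxfun (fun z => (ln z)%:C) (diag_mx (\row_j (x j)%:C) + t%:C *: K) i k
           - (ln (x i))%:C *+ (i == k)
           - (t * ln_divdiff (x i) (x k))%:C * K i k) <= M * t ^+ 2.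
Proof.
move=> x0 Kh K0.
(* The factor 2 leaves a gap: an eigenvalue below d is at distance at least d from every positive
   [x i]. *)
have [d d0 dx] : exists2 d, 0 < d & forall i, 0 < x i -> 2 * d <= x i.
  have [d d0 dx] := common_lower_bound x; exists (d / 2); first by rewrite divr_gt0.
  by move=> i /dx; rewrite mulrC divfK.
have dx1 i : 0 < x i -> d <= x i by move=> /dx; lra.
have rem i k : exists c : R, 0 <= c /\
    (0 < x i -> 0 < x k -> forall y, (y <= 0) \/ (d <= y) ->
    `|ln y - ln (x i) - ln_divdiff (x i) (x k) * (y - x i)| <=
      c * (`|y - x i| * `|y - x k|)).
  have [xi|] := boolP (0 < x i); last by exists 0.
  have [xk|] := boolP (0 < x k); last by exists 0.
  have [c c0 cP] := ln_newton_remainder d0 (dx1 i xi) (dx1 k xk).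
  by exists c; split.
have [cc' ccP'] := choice (fun p : 'I_n * 'I_n => rem p.1 p.2).
pose cc i k := cc' (i, k); have ccP i k := ccP' (i, k); rewrite /= in ccP.
pose c := \sum_i \sum_l normc (K i l).
have c0 : 0 <= c by apply: sumr_ge0 => i _; apply: sumr_ge0 => l _; exact: normc_ge0.
(* The radius is dictated by [ynear]: an eigenvalue in ]0, d[ would belong to a row of V with all
   entries at most 1 / (n + 1), whose squared norm is less than 1. *)
exists (\sum_i \sum_k n%:R * cc i k * c ^+ 2), (d / (n.+1%:R * (c + 1))).
have nc0 : 0 < n.+1%:R * (c + 1) :> R by rewrite mulr_gt0 // ltr_wpDl.
split; first by rewrite divr_gt0.
move=> t te; set Y := _ + _.
have Yh : Y ^t* = Y.
  apply/matrixP => i j; rewrite !mxE rmorphD rmorphM /= conjC_real.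
  have /matrixP/(_ i j) := Kh; rewrite !mxE => ->; congr (_ + _).
  by rewrite eq_sym; have [->|] := eqVneq i j; rewrite ?conjC0 // !mulr1n conjC_real.
have [V [y [Vu YE]]] := hermitian_conj_diag Yh.
pose KV := K *m V ^t*.
(* Entry (i, j) of the eigenvector equation Y V^* = V^* diag y, with the part coming from diag x
   moved to the left. *)
have eig i j : Num.conj (V j i) * (y j - x i)%:C = t%:C * KV i j.
  have : Y *m V ^t* = V ^t* *m diag_mx (\row_j (y j)%:C).
    by rewrite YE /conj_diag -!mulmxA (unitarymxP Vu) mulmx1.
  move/matrixP/(_ i j); rewrite /Y mulmxDl mxE mul_diag_mx mul_mx_diag -scalemxAl !mxE.
  move=> E; rewrite rmorphB mulrBr /= -E [_ * (x i)%:C]mulrC [X in X - _]addrC addrK.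
  by [].
have KVle i j : normc (KV i j) <= c.
  rewrite mxE (le_trans (normc_sum _ _ _)) //.
  rewrite (@le_trans _ _ (\sum_l normc (K i l))) //.
    apply: ler_sum => l _; rewrite normcM !mxE normc_conj ler_piMr ?normc_ge0 //.
    exact: unitarymx_entry_le1.
  rewrite /c [leRHS](bigD1 i) //= lerDl; apply: sumr_ge0 => k _.
  by apply: sumr_ge0 => l _; exact: normc_ge0.
have ale i j : normc (V j i) * `|y j - x i| <= c * `|t|.
  rewrite -normc_conj -normc_real -normcM eig normcM normc_real mulrC.
  by rewrite ler_wpM2r.
have colV i k : \sum_j Num.conj (V j i) * V j k = (i == k)%:R.
  have /matrixP/(_ i k) := unitarymx_adjM Vu; rewrite !mxE => <-.
  by apply: eq_bigr => j _; rewrite !mxE.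
have rowV j : \sum_i normc (V j i) ^+ 2 = 1.
  apply: complexI; rewrite rmorph_sum /=.
  have /matrixP/(_ j j) := unitarymxP Vu; rewrite !mxE eqxx /= => E.
  by apply: etrans E; apply: eq_bigr => k _; rewrite !mxE mul_conjC_normc.
have KE i k : t%:C * K i k = \sum_j Num.conj (V j i) * (y j - x i)%:C * V j k.
  under eq_bigr do rewrite eig -mulrA.
  rewrite -mulr_sumr; congr (_ * _).
  have : KV *m V = K by rewrite /KV -mulmxA unitarymx_adjM // mulmx1.
  by move/matrixP/(_ i k) => <-; rewrite mxE.
have ker i j : x i = 0 -> V j i = 0 \/ y j = 0.
  move=> xi; have := eig i j; rewrite xi subr0.
  have -> : KV i j = 0.
    by rewrite mxE big1 // => l _; rewrite K0 // mul0r.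
  rewrite mulr0 => /eqP; rewrite mulf_eq0 conjC_eq0 => /orP[/eqP|/eqP/complexI];
    by [left | right].
have ynear j : y j <= 0 \/ d <= y j.
  have [|yj] := leP (y j) 0; first by left.
  have [|yd] := leP d (y j); first by right.
  have small i : normc (V j i) <= n.+1%:R^-1.
    have := x0 i; rewrite le_eqVlt => /predU1P[/esym xi|xi].
      have [->|y0] := ker i j xi; first by rewrite normc0 invr_ge0.
      by rewrite y0 ltxx in yj.
    have h1 : normc (V j i) * d <= c * `|t|.
      rewrite (le_trans _ (ale i j)) // ler_wpM2l ?normc_ge0 // distrC ger0_norm.
        by have := dx i xi; lra.
      by have := dx i xi; lra.
    rewrite -(ler_pM2r d0) (le_trans h1) // mulrC.
    move: te; rewrite ltr_pdivlMr // => /ltW te.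
    rewrite ler_pdivlMl //; apply: le_trans te.
    by rewrite mulrCA ler_wpM2l // ler_wpM2l // lerDl.
  have := rowV j.
  have : \sum_i normc (V j i) ^+ 2 <= \sum_(i < n) n.+1%:R^-1 ^+ 2.
    by apply: ler_sum => i _; rewrite ler_sqr ?nnegrE ?invr_ge0 ?normc_ge0.
  rewrite sumr_const card_ord => h E; rewrite E in h; exfalso.
  move: h; apply/negP; rewrite -ltNge -[ltLHS]mulr_natl exprVn.
  rewrite ltr_pdivrMr ?exprn_gt0 // mul1r -natrX ltr_nat.
  by rewrite (leq_trans (ltnSn n)) // expnS expn1 leq_pmulr.
move=> i k.
have -> : mxfun (fun z => (ln z)%:C) Y i k - (ln (x i))%:C *+ (i == k)
           - (t * ln_divdiff (x i) (x k))%:C * K i k =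
    \sum_j Num.conj (V j i) * V j k *
      (ln (y j) - ln (x i) - ln_divdiff (x i) (x k) * (y j - x i))%:C.
  rewrite YE mxfun_conj_diag // conj_diagE.
  rewrite rmorphM mulrAC /= -mulrA mulrC mulrAC mulrC [_ * t%:C]mulrC KE.
  rewrite -mulr_natr -colV !mulr_sumr -!sumrB; apply: eq_bigr => j _.
  by rewrite !rmorphB rmorphM /= rmorphB /=; ring.
have M0 a b : 0 <= n%:R * cc a b * c ^+ 2.
  by rewrite !mulr_ge0 ?exprn_ge0 //; have [] := ccP a b.
have Mle : n%:R * cc i k * c ^+ 2 <= \sum_i \sum_k n%:R * cc i k * c ^+ 2.
  rewrite (bigD1 i) //= (bigD1 k) //= -addrA lerDl addr_ge0 ?sumr_ge0 //.
  by move=> j _; rewrite sumr_ge0.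
apply: le_trans (ler_wpM2r (sqr_ge0 t) Mle).
have Mt0 : 0 <= n%:R * cc i k * c ^+ 2 * t ^+ 2 := mulr_ge0 (M0 i k) (sqr_ge0 t).
have := x0 i; rewrite le_eqVlt => /predU1P[/esym xi|xi].
  rewrite big1 ?normc0 // => j _.
  have [->|yj] := ker i j xi; first by rewrite conjC0 !mul0r.
  by rewrite yj xi !subrr mulr0 subr0 mulr0.
have := x0 k; rewrite le_eqVlt => /predU1P[/esym xk|xk].
  (* Each summand has V j k = 0 or y j = 0, so the remainder may be replaced throughout by its value
     at 0. This constant factors out, and the sum vanishes because columns i and k of V are
     orthogonal. *)
  rewrite (eq_bigr (fun j => Num.conj (V j i) * V j k *
      (ln 0 - ln (x i) - ln_divdiff (x i) (x k) * (0 - x i))%:C)); last first.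
    by move=> j _; have [->|->] := ker k j xk; rewrite ?mulr0 ?mul0r.
  rewrite -mulr_suml colV; case: eqP => [ik|_].
    by rewrite ik xk ltxx in xi.
  by rewrite mul0r normc0.
rewrite (le_trans (normc_sum _ _ _)) //.
have -> : n%:R * cc i k * c ^+ 2 * t ^+ 2 = \sum_(j < n) cc i k * ((c * `|t|) * (c * `|t|)).
  by rewrite sumr_const card_ord -mulr_natl -[in LHS](real_normK (num_real t)); ring.
apply: ler_sum => j _.
rewrite normcM normc_real normcM normc_conj.
have [ck0 ckP] := ccP i k.
rewrite (le_trans (ler_wpM2l _ (ckP xi xk _ (ynear j)))) ?mulr_ge0 ?normc_ge0 //.
rewrite mulrCA ler_wpM2l // mulrACA ler_pM ?mulr_ge0 ?normc_ge0 //.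
Qed.

End LogPerturbation.

(** * Differentiation of the logarithm compressed to the support *)

Section CompressedConjugation.
Context {C : numClosedFieldType}.
Local Open Scope sesquilinear_scope.

Lemma conj_diag_compress n (Q Phi : 'M[C]_n) (s x : 'I_n -> C) t :
  Q \is unitarymx -> (forall i, s i * x i * s i = x i) ->
  conj_diag Q s *m (conj_diag Q x + t *: Phi) *m conj_diag Q s =
  Q ^t* *m (diag_mx (\row_j x j) +
    t *: (diag_mx (\row_j s j) *m (Q *m Phi *m Q ^t*) *m diag_mx (\row_j s j))) *m Q.
Proof.
move=> Qu sx; rewrite mulmxDr !mulmxDl mulmxDr mulmxDl; congr (_ + _).
  rewrite !conj_diag_mul //; exact: eq_conj_diag.
by rewrite -!scalemxAr -!scalemxAl /conj_diag !mulmxA.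
Qed.

Lemma adjmxE n (A : 'M[C]_n) i k : (A ^t*) i k = Num.conj (A k i).
Proof. by rewrite !mxE. Qed.

Lemma diag_mx_sandwich n (s r : 'I_n -> C) (B : 'M[C]_n) i k :
  (diag_mx (\row_j s j) *m B *m diag_mx (\row_j r j)) i k = s i * B i k * r k.
Proof. by rewrite mul_mx_diag mxE mul_diag_mx !mxE. Qed.

Lemma conjmx_entry n (Q G : 'M[C]_n) p q :
  (Q ^t* *m G *m Q) p q = \sum_i \sum_k Num.conj (Q i p) * G i k * Q k q.
Proof.
rewrite mxE exchange_big /=; apply: eq_bigr => k _.
by rewrite mxE mulr_suml; apply: eq_bigr => i _; rewrite !mxE.
Qed.

End CompressedConjugation.

Section DerivativeLog.
Context {R : realType}.
Local Open Scope sesquilinear_scope.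
Local Notation C := R[i].

(** At t = 0 the bound forces f 0 = a; elsewhere it makes the difference quotient differ from D by
    at most M |t|. *)
Lemma is_derive_quadratic (f : R -> R) (a D M e : R) : 0 < e ->
  (forall t, `|t| < e -> `|f t - a - t * D| <= M * t ^+ 2) -> is_derive (0 : R) 1 f D.
Proof.
move=> e0 fM.
have f0 : f 0 = a.
  have := fM 0; rewrite normr0 expr0n mulr0 mul0r subr0 => /(_ e0).
  by rewrite normr_le0 subr_eq0 => /eqP.
have H : ((h^-1 *: (f (h *: 1 + 0) - f 0)) @[h --> 0^'] --> D)%classic.
  apply/cvgrPdist_le => eps eps0; near=> h.
  have h0 : h != 0 by near: h; exact: nbhs_dnbhs_neq.
  have he : `|h| < e by near: h; exact: dnbhs0_lt.
  have hM : `|h| <= eps / (`|M| + 1).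
    by near: h; apply: dnbhs0_le; rewrite divr_gt0 // ltr_wpDl.
  rewrite /GRing.scale /= mulr1 addr0 f0 distrC.
  rewrite (_ : h^-1 * _ - D = h^-1 * (f h - a - h * D)); last by field.
  rewrite normrM normfV mulrC ler_pdivrMr ?normr_gt0 //.
  rewrite (le_trans (fM _ he)) // -(real_normK (num_real h)) expr2 mulrA.
  rewrite ler_wpM2r // (le_trans (ler_wpM2r _ (ler_norm M))) //.
  move: hM; rewrite ler_pdivlMr ?ltr_wpDl // => hM.
  have := normr_ge0 h; have := normr_ge0 M; nra.
split; first by apply/cvg_ex; exists D.
exact: cvg_lim H.
Unshelve. all: end_near. Qed.

Lemma Re_affine (u a z : C) (t : R) :
  complex.Re (u - a - t%:C * z) = complex.Re u - complex.Re a - t * complex.Re z.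
Proof. by case: u a z => [u1 u2] [a1 a2] [z1 z2] /=; ring. Qed.

Lemma Im_affine (u a z : C) (t : R) :
  complex.Im (u - a - t%:C * z) = complex.Im u - complex.Im a - t * complex.Im z.
Proof. by case: u a z => [u1 u2] [a1 a2] [z1 z2] /=; ring. Qed.

(** In the eigenbasis of X, compression turns [Phi] into [K], whose rows and columns over the kernel
    of X vanish. This is what [ln_perturbation] asks for, and it produces the zeros of the
    multiplier. *)
Lemma is_derive_log_on n (Q Phi : 'M[C]_n) (x : 'I_n -> R) :
  Q \is unitarymx -> (forall i, 0 <= x i) -> Phi ^t* = Phi ->
  let X := conj_diag Q (fun i => (x i)%:C) in
  is_derive_mx 0 (fun t : R => log_on X (X + t%:C *: Phi))
    (Q ^t* *m (\matrix_(i, k) ((if (x i != 0) && (x k != 0)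
       then ln_divdiff (x i) (x k) else 0)%:C * (Q *m Phi *m Q ^t*) i k)) *m Q).
Proof.
move=> Qu x0 Ph X.
pose s i : C := (x i != 0)%:R.
have sx i : s i * (x i)%:C * s i = (x i)%:C.
  by rewrite /s; case: eqP => [->|_]; rewrite ?mulr0 ?mul0r // mul1r mulr1.
set B := Q *m Phi *m Q ^t*.
pose K := diag_mx (\row_j s j) *m B *m diag_mx (\row_j s j).
have KE i k : K i k = s i * B i k * s k by exact: diag_mx_sandwich.
have Bh : B ^t* = B by rewrite /B !trmx_mul !map_mxM trmxCK Ph mulmxA.
have sR i : Num.conj (s i) = s i by rewrite /s conjC_nat.
have Kh : K ^t* = K.
  apply/matrixP => i k; rewrite adjmxE !KE !rmorphM /= !sR -adjmxE Bh; ring.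
have K0 i k : x i = 0 -> K i k = 0 by move=> xi; rewrite KE /s xi eqxx !mul0r.
have [M [e [e0 MP]]] := ln_perturbation x0 Kh K0.
have FE (t : R) : log_on X (X + t%:C *: Phi) =
    Q ^t* *m mxfun (fun z => (ln z)%:C) (diag_mx (\row_j (x j)%:C) + t%:C *: K) *m Q.
  rewrite /log_on /X suppmx_conj_diag // conj_diag_compress //.
  rewrite mxfun_conj //.
  apply/matrixP => i j; rewrite !mxE rmorphD rmorphM /= conjC_real.
  have /matrixP/(_ i j) := Kh; rewrite !mxE => ->; congr (_ + _).
  by rewrite eq_sym; have [->|] := eqVneq i j; rewrite ?conjC0 // !mulr1n conjC_real.
set D := \matrix_(i, k) _.
have DE i k : (ln_divdiff (x i) (x k))%:C * K i k = D i k.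
  rewrite KE [D i k]mxE /s.
  by case: (x i != 0); case: (x k != 0); rewrite /= ?mul0r ?mulr0 ?mulr1 ?mul1r.
pose A : 'M[C]_n := Q ^t* *m (\matrix_(i, k) ((ln (x i))%:C *+ (i == k))) *m Q.
have key p q t : `|t| < e ->
    normc ((log_on X (X + t%:C *: Phi)) p q - A p q - t%:C * (Q ^t* *m D *m Q) p q)
      <= (\sum_(i < n) \sum_(k < n) M) * t ^+ 2.
  move=> te; rewrite FE !conjmx_entry mulr_sumr -!sumrB.
  rewrite (le_trans (normc_sum _ _ _)) // mulr_suml; apply: ler_sum => i _.
  rewrite mulr_sumr -!sumrB.
  rewrite (le_trans (normc_sum _ _ _)) // mulr_suml; apply: ler_sum => k _.
  set G := mxfun _ _.
  rewrite (_ : _ - _ - _ = Num.conj (Q i p) * (G i k - (ln (x i))%:C *+ (i == k)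
      - (t * ln_divdiff (x i) (x k))%:C * K i k) * Q k q).
    rewrite !normcM normc_conj (le_trans _ (MP t te i k)) // -[leRHS]mulr1.
    rewrite ler_pM ?mulr_ge0 ?normc_ge0 ?unitarymx_entry_le1 // -[leRHS]mul1r.
    by rewrite ler_pM ?normc_ge0 ?unitarymx_entry_le1.
  by rewrite -DE rmorphM /= [(\matrix_(_, _) _) _ _]mxE; ring.
move=> p q; split.
  apply: (@is_derive_quadratic _ (complex.Re (A p q)) _ _ _ e0) => t te.
  by rewrite -Re_affine; apply: le_trans (normr_Re_le _) (key p q t te).
apply: (@is_derive_quadratic _ (complex.Im (A p q)) _ _ _ e0) => t te.
by rewrite -Im_affine; apply: le_trans (normr_Im_le _) (key p q t te).
Qed.

End DerivativeLog.

(** * Choi operators *)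

Section TensorConjugation.
Context {C : numClosedFieldType}.
Local Open Scope sesquilinear_scope.

Lemma big_mxtens m n (F : 'I_(m * n) -> C) :
  \sum_p F p = \sum_i \sum_a F (mxtens_index (i, a)).
Proof.
rewrite pair_big (reindex (@mxtens_index m n)) /=; last first.
  by apply: onW_bij; exists (@mxtens_unindex m n);
    [exact: mxtens_indexK | exact: mxtens_unindexK].
by apply: eq_bigr => -[].
Qed.

Lemma tensmx_adj m n p q (A : 'M[C]_(m, n)) (B : 'M[C]_(p, q)) :
  (A *t B) ^t* = A ^t* *t B ^t*.
Proof. by rewrite trmx_tens map_mxT. Qed.

Lemma tensmx11 m n : (1%:M : 'M[C]_m) *t (1%:M : 'M[C]_n) = 1%:M.
Proof.
apply/matrixP => p q.
case: (mxtens_indexP p) => i a; case: (mxtens_indexP q) => j b.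
rewrite tensmxE !mxE (can_eq (@mxtens_indexK m n)) xpair_eqE -natrM mulnb.
by [].
Qed.

Lemma tensmx_unitary m n (U : 'M[C]_m) (V : 'M[C]_n) :
  U \is unitarymx -> V \is unitarymx -> U *t V \is unitarymx.
Proof.
move=> /unitarymxP Uu /unitarymxP Vu; apply/unitarymxP.
by rewrite tensmx_adj tensmx_mul Uu Vu tensmx11.
Qed.

Definition tens_fun m n (d : 'I_m -> C) (e : 'I_n -> C) (p : 'I_(m * n)) : C :=
  d (mxtens_unindex p).1 * e (mxtens_unindex p).2.

Lemma conj_diag_tens m n (U : 'M[C]_m) (V : 'M[C]_n) d e :
  conj_diag U d *t conj_diag V e = conj_diag (U *t V) (tens_fun d e).
Proof.
rewrite /conj_diag tensmx_adj -!tensmx_mul; congr (_ *m _ *m _).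
apply/matrixP => p q.
case: (mxtens_indexP p) => i a; case: (mxtens_indexP q) => j b.
rewrite tensmxE !mxE (can_eq (@mxtens_indexK m n)) xpair_eqE /tens_fun.
rewrite mxtens_indexK /=.
by case: eqP => _; case: eqP => _; rewrite ?mulr0 ?mul0r.
Qed.

Lemma conj_diag_conj n (Q : 'M[C]_n) d :
  map_mx Num.conj (conj_diag Q d) =
  conj_diag (map_mx Num.conj Q) (fun i => Num.conj (d i)).
Proof.
apply/matrixP => p q; rewrite mxE !conj_diagE rmorph_sum; apply: eq_bigr => i _.
by rewrite !rmorphM !mxE.
Qed.

Lemma conj_diag_tr n (Q : 'M[C]_n) d :
  (conj_diag Q d) ^T = conj_diag (map_mx Num.conj Q) d.
Proof.
apply/matrixP => p q; rewrite mxE !conj_diagE; apply: eq_bigr => i _.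
by rewrite !mxE conjCK; ring.
Qed.

End TensorConjugation.

(** * Entries and symmetries of Choi operators *)

Section Choi.
Context {R : realType}.
Local Open Scope sesquilinear_scope.
Local Notation C := R[i].

Lemma idtensE k n m (M : 'M[C]_n -> 'M[C]_m) (X : 'M[C]_(k * n)) i j a b :
  idtens M X (mxtens_index (i, a)) (mxtens_index (j, b)) = M (tensblock X i j) a b.
Proof.
rewrite /idtens summxE (bigD1 i) //= summxE (bigD1 j) //= tensmxE mxE !eqxx mul1r.
rewrite [X in _ + X + _]big1 ?addr0 => [|l lj]; last first.
  by rewrite tensmxE mxE eqxx eq_sym (negPf lj) mul0r.
rewrite big1 ?addr0 // => l li; rewrite summxE big1 // => r _.
by rewrite tensmxE mxE eq_sym (negPf li) mul0r.
Qed.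

Lemma maxent_ketE n i a : maxent_ket n (mxtens_index (i, a)) 0 = (i == a)%:R :> C.
Proof.
rewrite /maxent_ket summxE.
have E j : ((delta_mx j 0 : 'cV[C]_n) *t (delta_mx j 0 : 'cV[C]_n))
    (mxtens_index (i, a)) 0 = (i == j)%:R * (a == j)%:R.
  by rewrite !mxE !mxtens_indexK /= !ord1 !eqxx !andbT.
under eq_bigr do rewrite E.
rewrite (bigD1 i) //= eqxx mul1r big1 ?addr0 1?eq_sym // => j ji.
by rewrite eq_sym (negPf ji) mul0r.
Qed.

Lemma tensblock_maxent n i j : tensblock (maxent_op n) i j = delta_mx i j :> 'M[C]_n.
Proof.
apply/matrixP => a b; rewrite mxE /maxent_op mxE big_ord1.
rewrite !mxE !maxent_ketE conjC_nat -natrM mulnb.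
by rewrite eq_sym (eq_sym j).
Qed.

Lemma choiE n m (M : 'M[C]_n -> 'M[C]_m) i j a b :
  choi M (mxtens_index (i, a)) (mxtens_index (j, b)) = M (delta_mx i j) a b.
Proof. by rewrite /choi idtensE tensblock_maxent. Qed.

Lemma adjmap_delta n m (N : 'M[C]_n -> 'M[C]_m) k l c d :
  adjmap N (delta_mx k l) c d = N (delta_mx d c) l k.
Proof. by rewrite mxE mxtrace_mulC mxtrace_delta_mul. Qed.

Lemma adjmap_sum_delta n m (N : 'M[C]_n -> 'M[C]_m) phi c d :
  adjmap N phi c d = \sum_k \sum_l phi k l * adjmap N (delta_mx k l) c d.
Proof.
rewrite mxE /mxtrace exchange_big /=; apply: eq_bigr => k _.
by rewrite mxE; apply: eq_bigr => l _; rewrite adjmap_delta mulrC.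
Qed.

(** An operator on the input of a map moves to the other leg of the maximally entangled vector as
    its transpose. For the Hermitian [N sigma] the transpose is the complex conjugate, which is how
    the conjugate enters the theorem. *)
Lemma choi_sandwich n m (N : 'M[C]_n -> 'M[C]_m) (B B' : 'M[C]_m) (L L' : 'M[C]_n) :
  choi (fun g => L *m adjmap N (B *m g *m B') *m L') =
  (B ^T *t L) *m choi (adjmap N) *m (B' ^T *t L').
Proof.
apply/matrixP => p q.
case: (mxtens_indexP p) => i a; case: (mxtens_indexP q) => j b.
rewrite choiE mxE [RHS]mxE big_mxtens exchange_big /=; apply: eq_bigr => d _.
have bE k l : (B *m delta_mx i j *m B') k l = B k i * B' j l.
  rewrite -(mul_delta_mx (0 : 'I_1)) mulmxA -colE -mulmxA -rowE.
  by rewrite mxE big_ord1 !mxE.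
rewrite mxE mulr_suml.
have LE c : L a c * adjmap N (B *m delta_mx i j *m B') c d * L' d b =
    \sum_l \sum_k L a c * ((B *m delta_mx i j *m B') k l *
      adjmap N (delta_mx k l) c d) * L' d b.
  rewrite adjmap_sum_delta exchange_big /= mulr_sumr mulr_suml.
  by apply: eq_bigr => l _; rewrite mulr_sumr mulr_suml.
rewrite (eq_bigr _ (fun c _ => LE c)).
rewrite exchange_big /=; apply: eq_bigr => l _.
rewrite tensmxE mxE big_mxtens mulr_suml exchange_big /=.
under [RHS]eq_bigr => k _ do rewrite mulr_suml.
apply: eq_bigr => k _; apply: eq_bigr => c _.
by rewrite tensmxE choiE bE !mxE; ring.
Qed.

Lemma maxent_psd n : psdmx (maxent_op n : 'M[C]_(n * n)).
Proof.
move=> v; rewrite /maxent_op mulmxA -mulmxA.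
set k := maxent_ket n; set w := k ^t* *m v.
have -> : v ^t* *m k = w ^t* by rewrite /w trmx_mul map_mxM trmxCK.
by rewrite mxE big_ord1 !mxE mulrC mul_conjC_ge0.
Qed.

(** Complete positivity applied to [maxent_op] makes the Choi operator of [N] positive semidefinite,
    hence Hermitian; by [adjmap_delta] the entries of the Choi operator of the adjoint are a
    rearrangement of its entries. *)
Lemma choi_adjmap_adj n m (N : 'M[C]_n -> 'M[C]_m) : completely_positive N ->
  (choi (adjmap N)) ^t* = choi (adjmap N).
Proof.
move=> cp; have /psdmx_adj h := cp n _ (@maxent_psd n).
have hN i j a b : Num.conj (N (delta_mx j i) b a) = N (delta_mx i j) a b.
  have /matrixP/(_ (mxtens_index (i, a)) (mxtens_index (j, b))) := h.
  by rewrite adjmxE -/(choi N) !choiE.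
apply/matrixP => p q; rewrite adjmxE.
case: (mxtens_indexP p) => i a; case: (mxtens_indexP q) => j b.
by rewrite !choiE !adjmap_delta hN.
Qed.

Lemma quadE n (A : 'M[C]_n) (v : 'cV[C]_n) :
  (v ^t* *m A *m v) 0 0 = \sum_p \sum_q Num.conj (v p 0) * A p q * v q 0.
Proof.
rewrite mxE exchange_big /=; apply: eq_bigr => q _.
by rewrite mxE mulr_suml; apply: eq_bigr => p _; rewrite !mxE.
Qed.

(** Complete positivity with a one-dimensional ancilla. The sizes 1 * n and n are not convertible,
    so vectors are transported along [mxtens_index]. *)
Lemma completely_positive_psd n m (N : 'M[C]_n -> 'M[C]_m) s :
  completely_positive N -> psdmx s -> psdmx (N s).
Proof.
move=> cp ps.
have blk : tensblock ((1%:M : 'M[C]_1) *t s) 0 0 = s.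
  by apply/matrixP => a b; rewrite mxE tensmxE mxE eqxx mul1r.
have ps1 : psdmx ((1%:M : 'M[C]_1) *t s).
  move=> v; have := ps (\col_a v (mxtens_index (0, a)) 0).
  rewrite !quadE !big_mxtens big_ord1; congr (0 <= _); apply: eq_bigr => a _.
  rewrite big_mxtens big_ord1; apply: eq_bigr => b _.
  by rewrite tensmxE !mxE eqxx mul1r.
move=> v; have := cp 1 _ ps1 (\col_p v (mxtens_unindex p).2 0).
rewrite !quadE !big_mxtens big_ord1; congr (0 <= _); apply: eq_bigr => a _.
rewrite big_mxtens big_ord1; apply: eq_bigr => b _.
by rewrite !mxE !mxtens_indexK /= idtensE blk.
Qed.

End Choi.

(** * The twirled Petz map *)

Section ComplexIntegral.
Context {R : realType}.
Local Open Scope sesquilinear_scope.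
Local Notation C := R[i].
Local Notation mu := (@lebesgue_measure R).
Implicit Types (f g : R -> C) (c : C).

Definition cintegral f : C :=
  (\int[mu]_t complex.Re (f t)) +i* (\int[mu]_t complex.Im (f t)).

Definition rintegrable (h : R -> R) : Prop := mu.-integrable setT (EFin \o h).

Definition cintegrable f : Prop :=
  rintegrable (fun t => complex.Re (f t)) /\ rintegrable (fun t => complex.Im (f t)).

Lemma rintegrableD (h k : R -> R) : rintegrable h -> rintegrable k ->
  rintegrable (fun t => h t + k t).
Proof.
move=> ih ik; rewrite /rintegrable.
have -> : EFin \o (fun t => h t + k t) = ((EFin \o h) \+ (EFin \o k))%E.
  by apply/funext => t; rewrite /= EFinD.
exact: integrableD.
Qed.

Lemma rintegrableZ r (h : R -> R) : rintegrable h -> rintegrable (fun t => r * h t).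
Proof.
move=> ih; rewrite /rintegrable.
have -> : EFin \o (fun t => r * h t) = (fun t => (r%:E * (EFin \o h) t)%E).
  by apply/funext => t; rewrite /= EFinM.
exact: integrableZl.
Qed.

Lemma cintegrableD f g : cintegrable f -> cintegrable g ->
  cintegrable (fun t => f t + g t).
Proof.
move=> [f1 f2] [g1 g2]; split.
  under eq_fun do rewrite raddfD /=; exact: rintegrableD.
under eq_fun do rewrite raddfD /=; exact: rintegrableD.
Qed.

Lemma ReM (u v : C) : complex.Re (u * v) =
  complex.Re u * complex.Re v + - complex.Im u * complex.Im v.
Proof. by case: u v => [a b] [x y] /=; ring. Qed.

Lemma ImM (u v : C) : complex.Im (u * v) =
  complex.Re u * complex.Im v + complex.Im u * complex.Re v.
Proof. by case: u v => [a b] [x y] /=; ring. Qed.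

Lemma cintegrableZ c f : cintegrable f -> cintegrable (fun t => c * f t).
Proof.
move=> [f1 f2]; split.
  by under eq_fun do rewrite ReM; apply: rintegrableD; exact: rintegrableZ.
by under eq_fun do rewrite ImM; apply: rintegrableD; exact: rintegrableZ.
Qed.

Lemma cintegralD f g : cintegrable f -> cintegrable g ->
  cintegral (fun t => f t + g t) = cintegral f + cintegral g.
Proof.
move=> [f1 f2] [g1 g2]; rewrite /cintegral.
under eq_Rintegral do rewrite raddfD /=.
under [X in _ +i* X]eq_Rintegral do rewrite raddfD /=.
by rewrite !RintegralD.
Qed.

Lemma cintegralZ c f : cintegrable f ->
  cintegral (fun t => c * f t) = c * cintegral f.
Proof.
move=> [f1 f2]; rewrite /cintegral.
under eq_Rintegral do rewrite ReM.
under [X in _ +i* X]eq_Rintegral do rewrite ImM.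
rewrite !RintegralD ?RintegralZl //; try exact: rintegrableZ.
by case: c => a b; simpc; congr (_ +i* _); rewrite ?mulNr.
Qed.

Lemma cintegral_sum (I : finType) (c : I -> C) (f : I -> R -> C) :
  (forall i, cintegrable (f i)) ->
  cintegral (fun t => \sum_i c i * f i t) = \sum_i c i * cintegral (f i).
Proof.
move=> fi.
suff H (s : seq I) : cintegrable (fun t => \sum_(i <- s) c i * f i t) /\
    cintegral (fun t => \sum_(i <- s) c i * f i t) =
    \sum_(i <- s) c i * cintegral (f i) by have [] := H (index_enum I).
elim: s => [|i s [IH1 IH2]].
  under eq_fun do rewrite big_nil.
  rewrite big_nil /cintegral /cintegrable /= Rintegral_cst // mul0r; split=> //.
  by split; exact: integrable0.
under eq_fun do rewrite big_cons.
rewrite big_cons -IH2 -cintegralZ //; split.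
  by apply: cintegrableD => //; exact: cintegrableZ.
by rewrite cintegralD //; exact: cintegrableZ.
Qed.

Lemma Rintegral_odd (h : R -> R) : continuous h -> rintegrable h ->
  (forall t, h (- t) = - h t) -> \int[mu]_t h t = 0.
Proof.
move=> ch ih hN.
have I0 (n : nat) : \int[mu]_(t in `[- n.+1%:R, n.+1%:R]) h t = 0.
  have E : \int[mu]_(t in `[- n.+1%:R, n.+1%:R]) h t =
      - \int[mu]_(t in `[- n.+1%:R, n.+1%:R]) h t.
    have n0 : 0 < n.+1%:R :> R by rewrite ltr0n.
    rewrite [LHS]/Rintegral.
    have := @integration_by_substitution_oppr R h (- n.+1%:R) n.+1%:R.
    rewrite opprK => ->; [|lra|exact: continuous_subspaceT].
    rewrite -[RHS]mulN1r -RintegralZl //; last first.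
      apply: continuous_compact_integrable; first exact: segment_compact.
      exact: continuous_subspaceT.
    by congr fine; apply: eq_integral => t _; rewrite /= hN mulN1r.
  by move: E; move: (\int[mu]_(t in _) h t) => x; lra.
have L := cvg_integral_truncated ih.
pose In (n : nat) := \int[mu]_(t in `[- n.+1%:R, n.+1%:R]) h t.
have L0 : (In @ \oo --> (0 : R))%classic.
  by rewrite (_ : In = fun=> 0); [exact: cvg_cst | apply/funext => n; exact: I0].
exact: (cvg_unique _ L L0).
Qed.

Definition cis (s : R) : C := cos s +i* sin s.

Lemma cintegrable_beta0_cis w : cintegrable (fun t => (beta0 t)%:C * cis (w * t)).
Proof.
split; rewrite /rintegrable.
  under [X in EFin \o X]eq_fun do rewrite ReM /= oppr0 mul0r addr0.
  by apply: integrable_beta0M; [exact: continuous_cosM | move=> t; exact: normr_cos].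
under [X in EFin \o X]eq_fun do rewrite ImM /= mul0r addr0.
by apply: integrable_beta0M; [exact: continuous_sinM | move=> t; exact: normr_sin].
Qed.

Lemma cintegral_beta0_cis w :
  cintegral (fun t => (beta0 t)%:C * cis (w * t)) = (beta0_hat w)%:C.
Proof.
have [_ ii] := cintegrable_beta0_cis w.
rewrite /cintegral; congr (_ +i* _).
  by apply: eq_Rintegral => t _; rewrite ReM /= oppr0 mul0r addr0.
have E t : complex.Im ((beta0 t)%:C * cis (w * t)) = beta0 t * sin (w * t).
  by rewrite ImM /= mul0r addr0.
under eq_Rintegral do rewrite E.
apply: Rintegral_odd.
- by move=> t; apply: cvgM; [exact: continuous_beta0 | exact: continuous_sinM].
- by move: ii; under eq_fun do rewrite E.
- by move=> t; rewrite beta0N mulrN sinN mulrN.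
Qed.

Definition cexp (z : C) : C := (expR (complex.Re z))%:C * cis (complex.Im z).

Lemma cexpD z w : cexp (z + w) = cexp z * cexp w.
Proof.
case: z w => [a b] [x y]; rewrite /cexp /cis /= expRD cosD sinD.
by simpc; congr (_ +i* _); ring.
Qed.

Lemma cpow_cexp z (x : R) : 0 < x -> cpow z x = cexp (z * (ln x)%:C).
Proof.
move=> x0; rewrite /cpow x0 /cexp ReM ImM /= !mulr0 addr0 add0r.
by rewrite ?addr0 ?[_ + _ * ln x]addrC.
Qed.

Lemma cpow_npos z (x : R) : x <= 0 -> cpow z x = 0.
Proof. by move=> x0; rewrite /cpow ltNge x0. Qed.

Lemma cpowN1 (x : R) : cpow (- 1)%:C x = (if 0 < x then x^-1 else 0)%:C.
Proof.
have [x0|x0] := ltP 0 x; last by rewrite cpow_npos.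
rewrite cpow_cexp // /cexp ReM ImM /= /cis !(mulr0, mul0r, oppr0, addr0).
rewrite cos0 sin0 mulN1r expRN lnK ?posrE //.
by simpc.
Qed.

(** With s and w the half-sum and half-difference of the logarithms, x - y = 2 exp s sinh w and ln x
    - ln y = 2 w, so the divided difference is exp (- s) w / sinh w. The case x = y is
    [beta0_hat0]. *)
Lemma beta0_hat_ln_divdiff (x y : R) : 0 < x -> 0 < y ->
  expR (- ((ln x + ln y) / 2)) * beta0_hat ((ln x - ln y) / 2) = ln_divdiff x y.
Proof.
move=> x0 y0; rewrite /ln_divdiff; have [->|xy] := eqVneq x y.
  rewrite subrr mul0r beta0_hat0 mulr1 (_ : (ln y + ln y) / 2 = ln y); last by field.
  by rewrite expRN lnK // posrE.
set w := (ln x - ln y) / 2; set s := (ln x + ln y) / 2.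
have xE : x = expR s * expR w by rewrite -expRD (_ : s + w = ln x) ?lnK ?posrE // /s /w; field.
have yE : y = expR s * expR (- w) by rewrite -expRD (_ : s - w = ln y) ?lnK ?posrE // /s /w; field.
have := beta0_hatE w; rewrite (_ : 2 * w = ln x - ln y); last by rewrite /w; field.
have xyE : x - y = expR s * (expR w - expR (- w)) by rewrite mulrBr -xE -yE.
have : x - y != 0 by rewrite subr_eq0.
rewrite xyE mulf_eq0 negb_or => /andP[_ ew] <-; rewrite expRN.
by field; rewrite ew gt_eqF // expR_gt0.
Qed.

(* The eigenvalue of conj (N sigma) (x) sigma^-1 at eigenvalues b and a. *)
Definition petz_eig (b a : R) : R := b * (if 0 < a then a^-1 else 0).

(** Eigenvalues of the left tensor factor from [choi_sandwich], and below of the right one. For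
    positive b and a they are (b / a)^((-1 + it)/2) and (b / a)^((-1 - it)/2); kept as products of
    [cpow], they inherit the value 0 on the kernels. *)
Definition petz_weight_l t b a : C :=
  (cpow (- (1 / 2))%:C b * cpow (0 +i* (t / 2)) b) *
  (cpow (0 -i* (t / 2)) a * cpow (1 / 2)%:C a).

Definition petz_weight_r t b a : C :=
  (cpow (0 -i* (t / 2)) b * cpow (- (1 / 2))%:C b) *
  (cpow (1 / 2)%:C a * cpow (0 +i* (t / 2)) a).

Lemma petz_weight_l0 t b a : 0 <= b -> petz_eig b a = 0 -> petz_weight_l t b a = 0.
Proof.
rewrite le_eqVlt => /predU1P[<- _|b0].
  by rewrite /petz_weight_l (@cpow_npos _ 0) // !mul0r.
rewrite /petz_eig; have [a0|a0] := ltP 0 a; last first.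
  by rewrite /petz_weight_l !(cpow_npos _ a0) !mulr0.
by move=> /eqP; rewrite gt_eqF // mulr_gt0 // invr_gt0.
Qed.

Lemma petz_weight_r0 t b a : 0 <= b -> petz_eig b a = 0 -> petz_weight_r t b a = 0.
Proof.
rewrite le_eqVlt => /predU1P[<- _|b0].
  by rewrite /petz_weight_r (@cpow_npos _ 0) // !mul0r.
rewrite /petz_eig; have [a0|a0] := ltP 0 a; last first.
  by rewrite /petz_weight_r !(cpow_npos _ a0) !mulr0.
by move=> /eqP; rewrite gt_eqF // mulr_gt0 // invr_gt0.
Qed.

Lemma petz_eig_neq0 b a : 0 <= b -> petz_eig b a != 0 ->
  [/\ 0 < b, 0 < a, 0 < petz_eig b a & ln (petz_eig b a) = ln b - ln a].
Proof.
rewrite /petz_eig le_eqVlt => /predU1P[<-|b0]; first by rewrite mul0r eqxx.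
have [a0 _|] := ltP 0 a; last by rewrite mulr0 eqxx.
by split => //; rewrite ?divr_gt0 // ln_div ?posrE.
Qed.

(** The exponents add up: the half-sum of the two logarithms survives in the modulus, their
    half-difference in the phase. *)
Let weightE t b1 a1 b2 a2 : 0 <= b1 -> 0 <= b2 ->
  petz_eig b1 a1 != 0 -> petz_eig b2 a2 != 0 ->
  (beta0 t)%:C * (petz_weight_l t b1 a1 * petz_weight_r t b2 a2) =
  (expR (- ((ln (petz_eig b1 a1) + ln (petz_eig b2 a2)) / 2)))%:C *
   ((beta0 t)%:C * cis ((ln (petz_eig b1 a1) - ln (petz_eig b2 a2)) / 2 * t)).
Proof.
move=> hb1 hb2 /(petz_eig_neq0 hb1)[b10 a10 _ ->] /(petz_eig_neq0 hb2)[b20 a20 _ ->].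
rewrite /petz_weight_l /petz_weight_r !cpow_cexp // -!cexpD.
rewrite [RHS]mulrCA; congr (_ * _).
move: (ln b1) (ln a1) (ln b2) (ln a2) => x1 y1 x2 y2.
rewrite (_ : _ + _ = (- ((x1 - y1 + (x2 - y2)) / 2)) +i* ((x1 - y1 - (x2 - y2)) / 2 * t)) //.
by simpc; congr (_ +i* _); field.
Qed.

Lemma cintegrable_petz_weight b1 a1 b2 a2 : 0 <= b1 -> 0 <= b2 ->
  cintegrable (fun t => (beta0 t)%:C * (petz_weight_l t b1 a1 * petz_weight_r t b2 a2)).
Proof.
move=> hb1 hb2.
have z0 : cintegrable (fun _ : R => 0) by split; exact: integrable0.
have [e1|e1] := eqVneq (petz_eig b1 a1) 0.
  by under eq_fun do rewrite petz_weight_l0 // mul0r mulr0.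
have [e2|e2] := eqVneq (petz_eig b2 a2) 0.
  by under eq_fun do rewrite petz_weight_r0 // !mulr0.
under eq_fun do rewrite weightE //.
exact/cintegrableZ/cintegrable_beta0_cis.
Qed.

Lemma cintegral_petz_weight b1 a1 b2 a2 : 0 <= b1 -> 0 <= b2 ->
  cintegral (fun t => (beta0 t)%:C * (petz_weight_l t b1 a1 * petz_weight_r t b2 a2)) =
  (if (petz_eig b1 a1 != 0) && (petz_eig b2 a2 != 0)
   then ln_divdiff (petz_eig b1 a1) (petz_eig b2 a2) else 0)%:C.
Proof.
move=> hb1 hb2.
have z0 : cintegral (fun _ : R => 0) = 0 by rewrite /cintegral /= Rintegral_cst // mul0r.
have [e1|e1] := eqVneq (petz_eig b1 a1) 0.
  by under eq_fun do rewrite petz_weight_l0 // mul0r mulr0.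
have [e2|e2] := eqVneq (petz_eig b2 a2) 0.
  by under eq_fun do rewrite petz_weight_r0 // !mulr0.
under eq_fun do rewrite weightE //.
rewrite cintegralZ; last exact: cintegrable_beta0_cis.
rewrite cintegral_beta0_cis -rmorphM /= beta0_hat_ln_divdiff //.
  by have [] := petz_eig_neq0 hb1 e1.
by have [] := petz_eig_neq0 hb2 e2.
Qed.

End ComplexIntegral.

(** * The Choi operator of the twirled Petz map as a Schur product *)

Section SandwichDiagonal.
Context {C : numClosedFieldType}.
Local Open Scope sesquilinear_scope.

Lemma conj_diag_sandwich n (Q Phi : 'M[C]_n) (z r : 'I_n -> C) :
  conj_diag Q z *m Phi *m conj_diag Q r =
  Q ^t* *m (diag_mx (\row_j z j) *m (Q *m Phi *m Q ^t*) *m diag_mx (\row_j r j)) *m Q.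
Proof. by rewrite /conj_diag !mulmxA. Qed.

Lemma conj_diag_sandwichE n (Q Phi : 'M[C]_n) (z r : 'I_n -> C) p q :
  (conj_diag Q z *m Phi *m conj_diag Q r) p q =
  \sum_(ik : 'I_n * 'I_n) Num.conj (Q ik.1 p) * (Q *m Phi *m Q ^t*) ik.1 ik.2 *
    Q ik.2 q * (z ik.1 * r ik.2).
Proof.
rewrite conj_diag_sandwich conjmx_entry pair_bigA; apply: eq_bigr => -[i k] _ /=.
by rewrite diag_mx_sandwich; ring.
Qed.

Lemma mulmx_sandwich m n p q r s (A1 : 'M[C]_(m, n)) (A2 : 'M[C]_(n, p))
    (Y : 'M[C]_(p, q)) (B1 : 'M[C]_(q, r)) (B2 : 'M[C]_(r, s)) :
  A1 *m (A2 *m Y *m B1) *m B2 = (A1 *m A2) *m Y *m (B1 *m B2).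
Proof. by rewrite !mulmxA. Qed.

Lemma conj_unitary n (Q : 'M[C]_n) : Q \is unitarymx -> map_mx Num.conj Q \is unitarymx.
Proof. by rewrite conjC_unitary. Qed.

Lemma conj_diag_tr_tens m n (Q : 'M[C]_m) (V : 'M[C]_n) d d' e e' :
  Q \is unitarymx -> V \is unitarymx ->
  (conj_diag Q d *m conj_diag Q d') ^T *t (conj_diag V e *m conj_diag V e') =
  conj_diag (map_mx Num.conj Q *t V) (tens_fun (fun i => d i * d' i) (fun i => e i * e' i)).
Proof. by move=> Qu Vu; rewrite !conj_diag_mul // conj_diag_tr conj_diag_tens. Qed.

End SandwichDiagonal.

Section ChoiTwirledPetz.
Context {R : realType}.
Local Open Scope sesquilinear_scope.
Local Notation C := R[i].
Context (n m : nat) (N : 'M[C]_n -> 'M[C]_m) (sigma : 'M[C]_n).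
Context (V : 'M[C]_n) (a : 'I_n -> R) (Q : 'M[C]_m) (b : 'I_m -> R).
Context (Vu : V \is unitarymx) (Qu : Q \is unitarymx).
Context (sigmaE : sigma = conj_diag V (fun i => (a i)%:C)).
Context (NsigmaE : N sigma = conj_diag Q (fun i => (b i)%:C)).
Context (b0 : forall i, 0 <= b i).

Let U : 'M[C]_(m * n) := map_mx Num.conj Q *t V.
Let x (p : 'I_(m * n)) : R := petz_eig (b (mxtens_unindex p).1) (a (mxtens_unindex p).2).

Let Uu : U \is unitarymx.
Proof. exact: tensmx_unitary (conj_unitary Qu) Vu. Qed.

Let powsigma z : mxpow sigma z = conj_diag V (fun i => cpow z (a i)).
Proof. by rewrite sigmaE; exact: (mxfun_conj_diag (cpow z) a Vu). Qed.

Let powNsigma z : mxpow (N sigma) z = conj_diag Q (fun i => cpow z (b i)).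
Proof. rewrite NsigmaE; exact: (mxfun_conj_diag (cpow z) b Qu). Qed.

Lemma petz_log_argument :
  map_mx Num.conj (N sigma) *t mxpow sigma (- 1)%:C = conj_diag U (fun p => (x p)%:C).
Proof.
rewrite powsigma NsigmaE conj_diag_conj conj_diag_tens; apply: eq_conj_diag => p.
by rewrite /tens_fun conjC_real cpowN1 -rmorphM.
Qed.

(** The rotated Petz map at time t with adjacent powers grouped, so that it has the shape required
    by [choi_sandwich]. *)
Let twirl t (g : 'M[C]_m) : 'M[C]_n :=
  (mxpow sigma (0 -i* (t / 2)) *m mxpow sigma (1 / 2)%:C) *m
  adjmap N ((mxpow (N sigma) (- (1 / 2))%:C *m mxpow (N sigma) (0 +i* (t / 2))) *m g *m
            (mxpow (N sigma) (0 -i* (t / 2)) *m mxpow (N sigma) (- (1 / 2))%:C)) *m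
  (mxpow sigma (1 / 2)%:C *m mxpow sigma (0 +i* (t / 2))).

Let twirlE t g : mxpow sigma (0 -i* (t / 2))
       *m petz sigma N (mxpow (N sigma) (0 +i* (t / 2)) *m g
                          *m mxpow (N sigma) (0 -i* (t / 2)))
       *m mxpow sigma (0 +i* (t / 2)) = twirl t g.
Proof.
rewrite /petz /twirl -(mulmx_sandwich (mxpow (N sigma) _)); exact: mulmx_sandwich.
Qed.

Let choi_twirl t : choi (twirl t) =
  conj_diag U (fun p => petz_weight_l t (b (mxtens_unindex p).1) (a (mxtens_unindex p).2))
  *m choi (adjmap N) *m
  conj_diag U (fun p => petz_weight_r t (b (mxtens_unindex p).1) (a (mxtens_unindex p).2)).
Proof.
rewrite /twirl choi_sandwich !powsigma !powNsigma.
congr (_ *m _ *m _); exact: conj_diag_tr_tens.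
Qed.

(** By [choiE] and the entrywise integral, the Choi operator passes under the integral sign. In the
    eigenbasis [U] each entry is a finite sum over pairs of eigenvalues, and t enters each term only
    through the scalar integrand of [cintegral_petz_weight]. *)
Lemma choi_twirled_petz :
  choi (twirled_petz sigma N) =
  U ^t* *m (\matrix_(i, k) ((if (x i != 0) && (x k != 0)
       then ln_divdiff (x i) (x k) else 0)%:C *
         (U *m choi (adjmap N) *m U ^t*) i k)) *m U.
Proof.
apply/matrixP => p q.
case: (mxtens_indexP p) => i c; case: (mxtens_indexP q) => j d.
rewrite choiE mxE -/(cintegral (fun t => _)).
set B := U *m choi (adjmap N) *m U ^t*.
set p' := mxtens_index (i, c); set q' := mxtens_index (j, d).
have E t : ((beta0 t)%:C *: (mxpow sigma (0 -i* (t / 2))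
       *m petz sigma N (mxpow (N sigma) (0 +i* (t / 2)) *m delta_mx i j
                          *m mxpow (N sigma) (0 -i* (t / 2)))
       *m mxpow sigma (0 +i* (t / 2)))) c d =
    \sum_(ik : 'I_(m * n) * 'I_(m * n)) Num.conj (U ik.1 p') * B ik.1 ik.2 * U ik.2 q' *
      ((beta0 t)%:C * (petz_weight_l t (b (mxtens_unindex ik.1).1) (a (mxtens_unindex ik.1).2)
        * petz_weight_r t (b (mxtens_unindex ik.2).1) (a (mxtens_unindex ik.2).2))).
  rewrite twirlE mxE -choiE choi_twirl conj_diag_sandwichE mulr_sumr.
  by apply: eq_bigr => ik _; rewrite mulrCA.
under eq_fun do rewrite E.
rewrite cintegral_sum; last by move=> ik; exact: cintegrable_petz_weight.
rewrite conjmx_entry pair_bigA; apply: eq_bigr => -[u v] _ /=.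
rewrite cintegral_petz_weight // [(\matrix_(_, _) _) _ _]mxE -/(x u) -/(x v).
by rewrite -/B; ring.
Qed.

Lemma petz_eig_ge0 p : 0 <= x p.
Proof. by rewrite mulr_ge0 //; case: ltP => // a0; rewrite invr_ge0 ltW. Qed.

End ChoiTwirledPetz.

Theorem mainTheorem6 (R : realType) (dA dB : nat)
    (N : {linear 'M[R[i]]_dA -> 'M[R[i]]_dB}) (sigma : 'M[R[i]]_dA)
    (hN : quantum_channel N) (hsigma : density sigma) :
  let X := map_mx Num.conj (N sigma) *t mxpow sigma (- 1)%:C in
  is_derive_mx 0 (fun t : R => log_on X (X + t%:C *: choi (adjmap N)))
    (choi (twirled_petz sigma N)).
Proof.
move=> X; have [cpN _] := hN; have [psigma _] := hsigma.
have pNsigma := completely_positive_psd cpN psigma.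
have [V [a [Vu sigmaE]]] := hermitian_conj_diag (psdmx_adj psigma).
have [Q [b [Qu NsigmaE]]] := hermitian_conj_diag (psdmx_adj pNsigma).
have b0 : forall i, 0 <= b i.
  by apply: (psdmx_conj_diag_ge0 Qu); rewrite -NsigmaE.
rewrite /X (petz_log_argument Vu sigmaE NsigmaE).
rewrite (choi_twirled_petz Vu Qu sigmaE NsigmaE b0).
(* The point X and the claimed derivative are now written with the same unitary and the same
   eigenvalues, so the two Schur products coincide literally. *)
apply: is_derive_log_on.
- exact: tensmx_unitary (conj_unitary Qu) Vu.
- by move=> p; exact: petz_eig_ge0.
- exact: choi_adjmap_adj.
Qed.
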